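(* Let $V$ be the component of the free partially alternating ternary algebra over $\mathbb{Q}$ on $\{a,b,c,d,e\}$ spanned by the degree 7 monomials whose variables are a permutation of $a,a,a,b,c,d,e$, and let $N\subseteq V$ be the subspace of elements $f$ such that $f\equiv 0$ is satisfied by the partially alternating ternary sum. Then $N$ is one-dimensional: up to a scalar multiple there is exactly one identity for the partition $31111$. It has 60 terms and is $$I_{31111}^{(1)}=\frac14\sum_{\sigma\in S_5}\epsilon(\sigma)[[[a\,a^\sigma b^\sigma]\,a\,c^\sigma]\,d^\sigma e^\sigma]-\frac1{12}\sum_{\sigma\in S_5}\epsilon(\sigma)[[a\,[a^\sigma b^\sigma c^\sigma]\,a]\,d^\sigma e^\sigma]$$ $$\qquad-\frac1{12}\sum_{\sigma\in S_5}\epsilon(\sigma)[[a\,a^\sigma b^\sigma]\,[c^\sigma d^\sigma e^\sigma]\,a]-\frac16\sum_{\sigma\in S_5}\epsilon(\sigma)[a\,[[b^\sigma c^\sigma d^\sigma]\,a\,e^\sigma]\,a^\sigma],$$ where $S_5$ acts on $\{a,b,c,d,e\}$, the symbols $a$ without superscript are not permuted, and $[xyz]$ denotes the ternary product.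
   Context: The base field is $\mathbb{Q}$. An (associative) dialgebra is a vector space $A$ with two bilinear products $\dashv,\vdash$ satisfying $(a\dashv b)\dashv c=a\dashv(b\dashv c)$, $(a\vdash b)\vdash c=a\vdash(b\vdash c)$, $(a\vdash b)\dashv c=a\vdash(b\dashv c)$, $(a\dashv b)\vdash c=(a\vdash b)\vdash c$, $a\dashv(b\dashv c)=a\dashv(b\vdash c)$. The partially alternating ternary sum (PATS) is the trilinear operation on a dialgebra $$[a,b,c]=a\dashv b\dashv c-a\dashv c\dashv b-b\vdash a\dashv c+c\vdash a\dashv b+b\vdash c\vdash a-c\vdash b\vdash a .$$ A ternary algebra is a vector space with a trilinear product. A partially alternating ternary algebra (PATA) is a ternary algebra satisfying $[x,y,z]+[x,z,y]=0$ and $[v,[w,x,y],z]+[v,[x,w,y],z]=0$; every dialgebra is a PATA under the PATS. The free PATA is the quotient of the free ternary algebra by all consequences of these two identities. For an element $f$ of the free PATA, $f\equiv0$ is satisfied by the PATS if $f$ vanishes for all values of the variables in every dialgebra, with the ternary product interpreted as the PATS. A basis of the degree 7 part of the free PATA (with totally ordered generators) is given by the straightened monomials (1) $[[[x_1x_2x_3]x_4x_5]x_6x_7]$ with $x_2<x_3$, $x_4<x_5$, $x_6<x_7$; (2) $[[x_1[x_2x_3x_4]x_5]x_6x_7]$ with $x_2<x_3<x_4$, $x_6<x_7$; (3) $[[x_1x_2x_3][x_4x_5x_6]x_7]$ with $x_2<x_3$, $x_4<x_5<x_6$; (4) $[x_1[[x_2x_3x_4]x_5x_6]x_7]$ with $x_2<x_3<x_4$,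 $x_5<x_6$; (5) $[x_1[x_2x_3x_4][x_5x_6x_7]]$ with $x_2<x_3<x_4$, $x_5<x_6<x_7$ and $(x_2,x_3,x_4)<(x_5,x_6,x_7)$ lexicographically. The number of terms of an element is the number of straightened monomials with nonzero coefficient when it is written in this basis. Here $a<b<\cdots$, $\epsilon(\sigma)$ is the sign of $\sigma$, and $x^\sigma$ is the image of $x$ under $\sigma$. *)

(* Defs.v *)
From HB Require Import structures.
From mathcomp Require Import all_boot all_order perm all_algebra.
From mathcomp Require Import finmap.
From mathcomp.multinomials Require Import monalg.
From mathcomp.classical Require Import boolp.

Set Implicit Arguments.
Unset Strict Implicit.
Unset Printing Implicit Defensive.

Import GRing.Theory.
Local Open Scope ring_scope.
Local Open Scope quotient_scope.

(* dl is the product -| and dr is the product |- *)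
Record dialgebra := Dialgebra {
  dialg_car :> lmodType rat;
  dl : {bilinear dialg_car -> dialg_car -> dialg_car};
  dr : {bilinear dialg_car -> dialg_car -> dialg_car};
  dl_assoc : forall a b c, dl (dl a b) c = dl a (dl b c);
  dr_assoc : forall a b c, dr (dr a b) c = dr a (dr b c);
  dlr_assoc : forall a b c, dl (dr a b) c = dr a (dl b c);
  dr_bar : forall a b c, dr (dl a b) c = dr (dr a b) c;
  dl_bar : forall a b c, dl a (dl b c) = dl a (dr b c)
}.
Arguments dl {d}.
Arguments dr {d}.

Definition pats (D : dialgebra) (a b c : D) : D :=
  dl (dl a b) c - dl (dl a c) b - dl (dr b a) c + dl (dr c a) b
  + dr (dr b c) a - dr (dr c b) a.

Definition trilinear (T : lmodType rat) (br : T -> T -> T -> T) : Prop :=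
  [/\ forall y z, linear (fun x => br x y z),
      forall x z, linear (fun y => br x y z)
    & forall x y, linear (fun z => br x y z)].

Definition pata_identities (T : lmodType rat) (br : T -> T -> T -> T) : Prop :=
  (forall x y z, br x y z + br x z y = 0) /\
  (forall v w x y z, br v (br w x y) z + br v (br x w y) z = 0).

Section LinearClosure.
Variables U V : lmodType rat.
Implicit Types f g : U -> V.

Lemma linear_addf f g : linear f -> linear g -> linear (fun x => f x + g x).
Proof. by move=> lf lg k x y; rewrite lf lg scalerDr addrACA. Qed.

Lemma linear_oppf f : linear f -> linear (fun x => - f x).
Proof. by move=> lf k x y; rewrite lf opprD scalerN. Qed.

Lemma linear_dlr (D : dialgebra) (f : U -> D) (p : {bilinear D -> D -> D}) y :
  linear f -> linear (fun x => p (f x) y).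
Proof. by move=> lf k x z; rewrite lf linearPl. Qed.

Lemma linear_dll (D : dialgebra) (f : U -> D) (p : {bilinear D -> D -> D}) y :
  linear f -> linear (fun x => p y (f x)).
Proof. by move=> lf k x z; rewrite lf linearPr. Qed.

Lemma linear_fun0 f : linear f -> f 0 = 0.
Proof. by move=> lf; have:= lf (-1) 0 0; rewrite !scaleN1r oppr0 addr0 addNr. Qed.

Lemma linear_funD f : linear f -> {morph f : x y / x + y}.
Proof. by move=> lf x y; have:= lf 1 x y; rewrite !scale1r. Qed.

Lemma linear_funZ f : linear f -> forall k x, f (k *: x) = k *: f x.
Proof. by move=> lf k x; have:= lf k x 0; rewrite (linear_fun0 lf) !addr0. Qed.

Lemma linear_funB f : linear f -> {morph f : x y / x - y}.
Proof.
by move=> lf x y; rewrite (linear_funD lf) -scaleN1r (linear_funZ lf) scaleN1r.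
Qed.

Lemma linear_fun_sum f (I : Type) (r : seq I) (F : I -> U) :
  linear f -> f (\sum_(i <- r) F i) = \sum_(i <- r) f (F i).
Proof. by move=> lf; apply: big_morph; [apply: linear_funD | apply: linear_fun0]. Qed.

End LinearClosure.

Lemma linear_idf (U : lmodType rat) : linear (fun x : U => x).
Proof. by []. Qed.

Lemma pats_trilinear (D : dialgebra) : trilinear (@pats D).
Proof.
by split=> u v; rewrite /pats;
  do ![apply: linear_addf | apply: linear_oppf | apply: linear_dlr
     | apply: linear_dll | apply: linear_idf].
Qed.


Lemma alt6_cancel (V : zmodType) (A B C D E F : V) :
  A - B - C + D + E - F + (C - E - A + F + B - D) = 0.
Proof.
have -> : C - E - A + F + B - D = - (A - B - C + D + E - F).
  rewrite !opprD !opprK [RHS](ACl (3 * 5 * 1 * 6 * 2 * 4)%AC) /=.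
  by [].
by rewrite subrr.
Qed.

Section DialgebraPATA.
Variable D : dialgebra.
Implicit Types u v w x y z : D.

Lemma pats_barl u w x y : dl u (pats w x y + pats x w y) = 0.
Proof.
rewrite /pats !(linearDr, linearNr) /=.
rewrite !(dl_assoc, dlr_assoc, dl_bar, dr_bar, dr_assoc); exact: alt6_cancel.
Qed.

Lemma pats_barr u w x y : dr (pats w x y + pats x w y) u = 0.
Proof.
rewrite /pats !(linearDl, linearNl) /=.
rewrite !(dl_assoc, dlr_assoc, dl_bar, dr_bar, dr_assoc); exact: alt6_cancel.
Qed.

Lemma pats_pata : pata_identities (@pats D).
Proof.
split=> [x y z | v w x y z].
  rewrite /pats.
  have E (A B C E F G : D) :
      A - B - C + E + F - G + (B - A - E + C + G - F) = 0.
    have -> : B - A - E + C + G - F = - (A - B - C + E + F - G).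
      by rewrite !opprD !opprK [RHS](ACl (2 * 1 * 4 * 3 * 6 * 5)%AC).
    by rewrite subrr.
  exact: E.
have [_ plin _] := pats_trilinear D.
rewrite -(linear_funD (plin v z)) /pats.
have barl u := pats_barl u w x y; have barr u := pats_barr u w x y.
move: (pats w x y + pats x w y) barl barr => Z barl barr.
rewrite !barl !barr dr_assoc barr.
by rewrite !(linear0l, linear0r) !(addr0, subr0, oppr0).
Qed.

End DialgebraPATA.

Inductive tmon (X : Type) : Type :=
  | Leaf of X
  | Node of tmon X & tmon X & tmon X.
Arguments Leaf {X}.
Arguments Node {X}.

Fixpoint leaves (X : Type) (m : tmon X) : seq X :=
  match m with
  | Leaf x => [:: x]
  | Node l c r => leaves l ++ leaves c ++ leaves r
  end.

Section TmonChoice.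
Variable X : choiceType.

Fixpoint tmon_encode (m : tmon X) : GenTree.tree X :=
  match m with
  | Leaf x => GenTree.Leaf x
  | Node l c r =>
      GenTree.Node 0 [:: tmon_encode l; tmon_encode c; tmon_encode r]
  end.

Fixpoint tmon_decode (t : GenTree.tree X) : option (tmon X) :=
  match t with
  | GenTree.Leaf x => Some (Leaf x)
  | GenTree.Node _ [:: l; c; r] =>
      match tmon_decode l, tmon_decode c, tmon_decode r with
      | Some l', Some c', Some r' => Some (Node l' c' r')
      | _, _, _ => None
      end
  | _ => None
  end.

Lemma tmon_encodeK : pcancel tmon_encode tmon_decode.
Proof. by elim=> //= l -> c -> r ->. Qed.

HB.instance Definition _ := Choice.copy (tmon X) (pcan_type tmon_encodeK).

End TmonChoice.

(* The free ternary algebra on X: finitely supported rational combinations of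
   ternary monomials. *)
Definition free_ternary (X : choiceType) := {malg rat[tmon X]}.
HB.instance Definition _ (X : choiceType) := GRing.Lmodule.on (free_ternary X).

(* lext, fbr, pi_pata, scale_pata and br are locked because failed unifications
   would otherwise unfold them down to finitely supported functions. *)
HB.lock Definition lext (K : choiceType) (V : lmodType rat) (h : K -> V)
    (f : {malg rat[K]}) : V :=
  \sum_(k <- msupp f) f@_k *: h k.

Section LinearExtension.
Variables (K : choiceType) (V : lmodType rat) (h : K -> V).
Local Notation lext := (lext h).

Lemma lextEw (d : {fset K}) f : (msupp f `<=` d)%fset ->
  lext f = \sum_(k <- d) f@_k *: h k.
Proof.
move=> sfd; rewrite lext.unlock (big_fset_incl _ sfd) // => k _ kf.
by rewrite mcoeff_outdom // scale0r.
Qed.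

Lemma lext_linear : linear lext.
Proof.
move=> c f g; set d := (msupp f `|` msupp g)%fset.
have sfg : (msupp (c *: f + g) `<=` d)%fset.
  apply: fsubset_trans (msuppD_le _ _) _.
  by rewrite fsetSU // msuppZ_le.
rewrite (lextEw sfg) (@lextEw d f) ?fsubsetUl // (@lextEw d g) ?fsubsetUr //.
rewrite scaler_sumr -big_split /=; apply: eq_bigr => k _.
by rewrite mcoeffD mcoeffZ scalerDl scalerA.
Qed.

Lemma lextU k : lext << k >> = h k.
Proof. by rewrite lext.unlock msuppU oner_eq0 big_seq_fset1 mcoeffUU scale1r. Qed.

End LinearExtension.

Lemma lext_ext (K : choiceType) (V : lmodType rat) (f g : {malg rat[K]} -> V) :
  linear f -> linear g -> (forall k, f << k >> = g << k >>) -> f =1 g.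
Proof.
move=> lf lg fg x; rewrite (monalgE x) !linear_fun_sum //.
apply: eq_bigr => k _.
have -> : << x@_k *g k >> = x@_k *: << k >> :> {malg rat[K]}.
  by apply/malgP => k'; rewrite mcoeffZ !mcoeffU mulrnAr mulr1.
by rewrite !linear_funZ // fg.
Qed.

HB.lock Definition fbr (X : choiceType) (f g h : free_ternary X) :
    free_ternary X :=
  lext (fun m1 => lext (fun m2 => lext (fun m3 =>
    << Node m1 m2 m3 >> : free_ternary X) h) g) f.

Section FreeTernary.
Variable X : choiceType.
Local Notation F := (free_ternary X).
Local Notation fbr := (@fbr X).

Lemma lext_paraml (K : choiceType) (U V : lmodType rat) (h : U -> K -> V) f :
  (forall k, linear (h^~ k)) -> linear (fun u => lext (h u) f).
Proof.
move=> lh c x y; rewrite lext.unlock scaler_sumr -big_split; apply: eq_bigr => k _ /=.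
by rewrite lh scalerDr !scalerA mulrC.
Qed.

Lemma fbr_trilinear : trilinear fbr.
Proof.
rewrite fbr.unlock; split=> [y z|x z|x y]; first exact: lext_linear.
  by apply: lext_paraml => k; apply: lext_linear.
by apply: lext_paraml => k; apply: lext_paraml => k'; apply: lext_linear.
Qed.

Lemma fbrU m1 m2 m3 : fbr << m1 >> << m2 >> << m3 >> = << Node m1 m2 m3 >>.
Proof. by rewrite fbr.unlock !lextU. Qed.

(* The ideal of consequences of the two identities defining a PATA. *)
Inductive pata_cons : F -> Prop :=
  | PC_alt x y z : pata_cons (fbr x y z + fbr x z y)
  | PC_inner v w x y z :
      pata_cons (fbr v (fbr w x y) z + fbr v (fbr x w y) z)
  | PC_0 : pata_cons 0
  | PC_D f g : pata_cons f -> pata_cons g -> pata_cons (f + g)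
  | PC_Z (c : rat) f : pata_cons f -> pata_cons (c *: f)
  | PC_br1 f y z : pata_cons f -> pata_cons (fbr f y z)
  | PC_br2 x f z : pata_cons f -> pata_cons (fbr x f z)
  | PC_br3 x y f : pata_cons f -> pata_cons (fbr x y f).

Definition pata_ideal : {pred F} := fun f => `[< pata_cons f >].

Lemma pata_ideal_zmod : zmod_closed pata_ideal.
Proof.
split=> [|f g /asboolP pf /asboolP pg]; apply/asboolP; first exact: PC_0.
by apply: PC_D => //; rewrite -scaleN1r; apply: PC_Z.
Qed.

HB.instance Definition _ := GRing.isZmodClosed.Build F pata_ideal pata_ideal_zmod.

Definition free_pata := {ideal_quot pata_ideal}.
HB.instance Definition _ := GRing.Zmodule.on free_pata.
HB.instance Definition _ := EqQuotient.on free_pata.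

End FreeTernary.

HB.lock Definition pi_pata (X : choiceType) (f : free_ternary X) :
  free_pata X := \pi_(free_pata X) f.

HB.lock Definition scale_pata (X : choiceType) (c : rat) (q : free_pata X) :
  free_pata X := pi_pata (c *: repr q).

Section FreePATA.
Variable X : choiceType.
Local Notation F := (free_ternary X).
Local Notation free_pata := (free_pata X).
Implicit Types (f g h : F) (p q r : free_pata).

Lemma pi_pata_eq f g : (pi_pata f = pi_pata g) <-> pata_cons (f - g).
Proof.
rewrite pi_pata.unlock; split=> [/eqP|].
  by rewrite -Quotient.idealrBE => /asboolP.
by move=> fg; apply/eqP; rewrite -Quotient.idealrBE; apply/asboolP.
Qed.

Lemma repr_pata (q : free_pata) : pi_pata (repr q) = q.
Proof. by rewrite pi_pata.unlock; apply: reprK. Qed.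

Lemma pi_pataD : {morph @pi_pata X : f g / f + g}.
Proof. by move=> f g; rewrite pi_pata.unlock !piE. Qed.

Lemma scale_pata_pi c f : scale_pata c (pi_pata f) = pi_pata (c *: f).
Proof.
rewrite scale_pata.unlock; apply/pi_pata_eq; rewrite -scalerBr; apply: PC_Z.
by apply/pi_pata_eq; rewrite repr_pata.
Qed.

Fact scale_pataA c d q : scale_pata c (scale_pata d q) = scale_pata (c * d) q.
Proof. by rewrite -(repr_pata q) !scale_pata_pi scalerA. Qed.

Fact scale_pata1 : left_id 1 (@scale_pata X).
Proof. by move=> q; rewrite -(repr_pata q) scale_pata_pi scale1r. Qed.

Fact scale_pataDr : right_distributive (@scale_pata X) +%R.
Proof.
move=> c p q; rewrite -(repr_pata p) -(repr_pata q) -pi_pataD !scale_pata_pi.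
by rewrite scalerDr pi_pataD.
Qed.

Fact scale_pataDl q : {morph (@scale_pata X)^~ q : c d / c + d}.
Proof.
by move=> c d; rewrite -(repr_pata q) !scale_pata_pi scalerDl pi_pataD.
Qed.

HB.instance Definition _ := GRing.Zmodule_isLmodule.Build rat free_pata
  scale_pataA scale_pata1 scale_pataDr scale_pataDl.

Lemma pi_pata_linear : linear (@pi_pata X).
Proof. by move=> c f g; rewrite pi_pataD -scale_pata_pi. Qed.

End FreePATA.

HB.lock Definition br (X : choiceType) (p q r : free_pata X) : free_pata X :=
  pi_pata (fbr (repr p) (repr q) (repr r)).

Section FreePATATheory.
Variable X : choiceType.
Local Notation F := (free_ternary X).
Local Notation free_pata := (free_pata X).
Implicit Types (f g h : F) (p q r : free_pata).

Lemma br_pi f g h : br (pi_pata f) (pi_pata g) (pi_pata h) = pi_pata (fbr f g h).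
Proof.
have [l1 l2 l3] := @fbr_trilinear X.
have rep k : pata_cons (repr (pi_pata k) - k).
  by apply/pi_pata_eq; rewrite repr_pata.
rewrite br.unlock; transitivity (pi_pata (fbr f (repr (pi_pata g)) (repr (pi_pata h)))).
  by apply/pi_pata_eq; rewrite -(linear_funB (l1 _ _)); apply: PC_br1.
transitivity (pi_pata (fbr f g (repr (pi_pata h)))).
  by apply/pi_pata_eq; rewrite -(linear_funB (l2 _ _)); apply: PC_br2.
by apply/pi_pata_eq; rewrite -(linear_funB (l3 _ _)); apply: PC_br3.
Qed.

Lemma br_trilinear : trilinear (@br X).
Proof.
have [l1 l2 l3] := @fbr_trilinear X.
split=> u v k x y; rewrite -(repr_pata u) -(repr_pata v) -(repr_pata x)
  -(repr_pata y).
- by rewrite -pi_pata_linear !br_pi l1 pi_pata_linear.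
- by rewrite -pi_pata_linear !br_pi l2 pi_pata_linear.
- by rewrite -pi_pata_linear !br_pi l3 pi_pata_linear.
Qed.

Lemma br_pata : pata_identities (@br X).
Proof.
have pi0 f : pata_cons f -> pi_pata f = 0.
  move=> pf; rewrite -(linear_fun0 (@pi_pata_linear X)).
  by apply/pi_pata_eq; rewrite subr0.
split=> [x y z|v w x y z]; rewrite -(repr_pata x) -(repr_pata y) -(repr_pata z).
  by rewrite !br_pi -pi_pataD; apply/pi0/PC_alt.
rewrite -(repr_pata v) -(repr_pata w) !br_pi -pi_pataD.
exact/pi0/PC_inner.
Qed.

Section Evaluation.
Variables (D : dialgebra) (v : X -> D).

Fixpoint mon_eval (m : tmon X) : D :=
  match m with
  | Leaf x => v x
  | Node l c r => pats (mon_eval l) (mon_eval c) (mon_eval r)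
  end.

Definition free_eval (f : F) : D := lext mon_eval f.

(* The choice of representative is immaterial: see pata_eval_pi. *)
Definition pata_eval (q : free_pata) : D := free_eval (repr q).

Lemma free_eval_br f g h :
  free_eval (fbr f g h) = pats (free_eval f) (free_eval g) (free_eval h).
Proof.
have [f1 f2 f3] := @fbr_trilinear X; have [p1 p2 p3] := pats_trilinear D.
have lE : linear free_eval := lext_linear mon_eval.
move: f; apply: lext_ext => [c x y|c x y|m1]; rewrite ?f1 ?lE ?p1 //.
move: g; apply: lext_ext => [c x y|c x y|m2]; rewrite ?f2 ?lE ?p2 //.
move: h; apply: lext_ext => [c x y|c x y|m3]; rewrite ?f3 ?lE ?p3 //.
by rewrite fbrU /free_eval !lextU.
Qed.

Lemma free_eval_cons f : pata_cons f -> free_eval f = 0.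
Proof.
have [p1 p2 p3] := pats_trilinear D; have [i1 i2] := pats_pata D.
have lE : linear free_eval := lext_linear mon_eval.
elim=> {f} [x y z|w x y z t||f g _ ef _ eg|c f _ ef|f y z _ ef|x f z _ ef
  |x y f _ ef].
- by rewrite (linear_funD lE) !free_eval_br i1.
- by rewrite (linear_funD lE) !free_eval_br i2.
- exact: linear_fun0 lE.
- by rewrite (linear_funD lE) ef eg addr0.
- by rewrite (linear_funZ lE) ef scaler0.
- by rewrite free_eval_br ef (linear_fun0 (p1 _ _)).
- by rewrite free_eval_br ef (linear_fun0 (p2 _ _)).
- by rewrite free_eval_br ef (linear_fun0 (p3 _ _)).
Qed.

Lemma pata_eval_pi f : pata_eval (pi_pata f) = free_eval f.
Proof.
apply/eqP; rewrite -subr_eq0 -(linear_funB (lext_linear mon_eval)).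
by apply/eqP/free_eval_cons/pi_pata_eq; rewrite repr_pata.
Qed.

End Evaluation.

Definition pats_identity (q : free_pata) : Prop :=
  forall (D : dialgebra) (v : X -> D), pata_eval v q = 0.

Definition gen (x : X) : free_pata := pi_pata << Leaf x >>.

End FreePATATheory.

Definition one_dimensional (V : lmodType rat) (N : V -> Prop) : Prop :=
  exists2 v, v != 0 & forall f, N f <-> exists c : rat, f = c *: v.

Section Straightened.
Variable n : nat.
Implicit Types x y z : 'I_n.

Definition lt3 x y z : bool := (x < y)%N && (y < z)%N.

Definition lex3 x y z x' y' z' : bool :=
  (x < x')%N || (x == x') && ((y < y')%N || (y == y') && (z < z')%N).

(* Only monomials of degree 7: one pattern for each of the five association
   types. *)
Definition straightened7 (m : tmon 'I_n) : bool :=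
  match m with
  | Node (Node (Node (Leaf x1) (Leaf x2) (Leaf x3)) (Leaf x4) (Leaf x5))
         (Leaf x6) (Leaf x7) => [&& (x2 < x3)%N, (x4 < x5)%N & (x6 < x7)%N]
  | Node (Node (Leaf x1) (Node (Leaf x2) (Leaf x3) (Leaf x4)) (Leaf x5))
         (Leaf x6) (Leaf x7) => lt3 x2 x3 x4 && (x6 < x7)%N
  | Node (Node (Leaf x1) (Leaf x2) (Leaf x3))
         (Node (Leaf x4) (Leaf x5) (Leaf x6)) (Leaf x7) =>
      (x2 < x3)%N && lt3 x4 x5 x6
  | Node (Leaf x1)
         (Node (Node (Leaf x2) (Leaf x3) (Leaf x4)) (Leaf x5) (Leaf x6))
         (Leaf x7) => lt3 x2 x3 x4 && (x5 < x6)%N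
  | Node (Leaf x1) (Node (Leaf x2) (Leaf x3) (Leaf x4))
         (Node (Leaf x5) (Leaf x6) (Leaf x7)) =>
      [&& lt3 x2 x3 x4, lt3 x5 x6 x7 & lex3 x2 x3 x4 x5 x6 x7]
  | _ => false
  end.

Definition straightened_form (q : free_pata 'I_n) (g : free_ternary 'I_n) : Prop :=
  (forall m, m \in msupp g -> straightened7 m) /\ pi_pata g = q.

(* The uniqueness clause makes the number of terms well defined. *)
Definition has_terms (q : free_pata 'I_n) (k : nat) : Prop :=
  exists g, [/\ straightened_form q g,
                forall g', straightened_form q g' -> g' = g
              & #|` msupp g| = k].

End Straightened.

(* The generators a < b < c < d < e are 0 < 1 < 2 < 3 < 4 in 'I_5. *)
Definition ga : 'I_5 := @Ordinal 5 0 isT.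
Definition gb : 'I_5 := @Ordinal 5 1 isT.
Definition gc : 'I_5 := @Ordinal 5 2 isT.
Definition gd : 'I_5 := @Ordinal 5 3 isT.
Definition ge : 'I_5 := @Ordinal 5 4 isT.

(* The span of the monomials with leaves a, a, a, b, c, d, e in some order. *)
Definition V31111 (f : free_pata 'I_5) : Prop :=
  exists g : free_ternary 'I_5,
    (forall m, m \in msupp g -> perm_eq (leaves m) [:: ga; ga; ga; gb; gc; gd; ge])
    /\ pi_pata g = f.

Definition N31111 (f : free_pata 'I_5) : Prop := V31111 f /\ pats_identity f.

(* (-1) ^+ s is the sign of s, and y s i is the image of the generator i under s. *)
Definition I31111 : free_pata 'I_5 :=
  let x := gen ga in
  let y (s : 'S_5) (i : 'I_5) := gen (s i) in
    4%:R^-1 *: (\sum_(s : 'S_5) (-1) ^+ s *: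
      br (br (br x (y s ga) (y s gb)) x (y s gc)) (y s gd) (y s ge))
  - 12%:R^-1 *: (\sum_(s : 'S_5) (-1) ^+ s *:
      br (br x (br (y s ga) (y s gb) (y s gc)) x) (y s gd) (y s ge))
  - 12%:R^-1 *: (\sum_(s : 'S_5) (-1) ^+ s *:
      br (br x (y s ga) (y s gb)) (br (y s gc) (y s gd) (y s ge)) x)
  - 6%:R^-1 *: (\sum_(s : 'S_5) (-1) ^+ s *:
      br x (br (br (y s gb) (y s gc) (y s gd)) x (y s ge)) (y s ga)).

(* Main.v *)
From HB Require Import structures.
From Stdlib Require Import NArith.
Require Import Defs.
From mathcomp Require Import all_boot all_order perm all_algebra.
From mathcomp Require Import finmap.
From mathcomp.multinomials Require Import monalg.

Set Implicit Arguments.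
Unset Strict Implicit.
Unset Printing Implicit Defensive.

Import GRing.Theory Num.Theory.
Local Open Scope ring_scope.

(* A subtree in the second or third slot of a bracket is alternating in its three
   arguments. Sorting such subtrees, and the last two arguments elsewhere, gives
   every monomial a signed normal form; in degree 7 the normal monomials are the
   straightened ones. Sending a monomial to its normal form defines a linear map
   that kills all consequences of the two identities, so the straightened monomials
   are linearly independent in the free algebra.

   In a dialgebra a monomial is a signed sum of words with one marked letter, and
   in the free dialgebra these words are independent. Being an identity of the PATS
   is thus a linear system in the coefficients of the 165 straightened monomials of
   content a, a, a, b, c, d, e. The expansion of I31111 cancels, so it solves the
   system; eliminating in 164 equations shows that a solution whose coefficient
   vanishes at the last monomial, which is a term of I31111, is zero. *)

(** * Signed sums and trilinear maps *)

Lemma linear_funN (U V : lmodType rat) (f : U -> V) : linear f -> {morph f : x / - x}.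
Proof. by move=> lf x; rewrite -scaleN1r (linear_funZ lf) scaleN1r. Qed.

(** A pair [(b, k)] stands for [(-1)^b k]. Lists of such pairs can be evaluated by computation,
    which finitely supported functions do not allow in practice. *)
Definition signed_sum (K : Type) (V : lmodType rat) (h : K -> V)
    (e : seq (bool * K)) : V :=
  \sum_(t <- e) (-1) ^+ t.1 *: h t.2.

Definition sbind (A B : Type) (e : seq (bool * A)) (f : A -> seq (bool * B)) :
    seq (bool * B) :=
  flatten [seq [seq (t.1 (+) u.1, u.2) | u <- f t.2] | t <- e].

Definition sbind3 (A B C D : Type) (f : A -> B -> C -> seq (bool * D)) e1 e2 e3 :=
  sbind e1 (fun a => sbind e2 (fun b => sbind e3 (f a b))).

Section SignedSum.
Variable V : lmodType rat.

Lemma signed_sum_cons (K : Type) (h : K -> V) t e :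
  signed_sum h (t :: e) = (-1) ^+ t.1 *: h t.2 + signed_sum h e.
Proof. by rewrite /signed_sum big_cons. Qed.

Lemma signed_sum_nil (K : Type) (h : K -> V) : signed_sum h [::] = 0.
Proof. by rewrite /signed_sum big_nil. Qed.

Lemma signed_sum1 (K : Type) (h : K -> V) t :
  signed_sum h [:: t] = (-1) ^+ t.1 *: h t.2.
Proof. by rewrite signed_sum_cons signed_sum_nil addr0. Qed.

Lemma signed_sum_cat (K : Type) (h : K -> V) e1 e2 :
  signed_sum h (e1 ++ e2) = signed_sum h e1 + signed_sum h e2.
Proof. by rewrite /signed_sum big_cat. Qed.

Lemma signed_sum_bind (A B : Type) (h : B -> V) e (f : A -> seq (bool * B)) :
  signed_sum h (sbind e f) = signed_sum (fun a => signed_sum h (f a)) e.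
Proof.
rewrite /signed_sum big_flatten big_map; apply: eq_bigr => t _.
rewrite big_map scaler_sumr; apply: eq_bigr => u _ /=.
by rewrite signr_addb scalerA.
Qed.

Lemma signed_sum_eq (K : Type) (h h' : K -> V) e :
  h =1 h' -> signed_sum h e = signed_sum h' e.
Proof. by move=> hh; apply: eq_bigr => t _; rewrite hh. Qed.

Lemma signed_sum_linear (U : lmodType rat) (K : Type) (h : K -> U) (f : U -> V) e :
  linear f -> f (signed_sum h e) = signed_sum (f \o h) e.
Proof.
move=> lf; rewrite linear_fun_sum //; apply: eq_bigr => t _.
by rewrite linear_funZ.
Qed.

(** The passage from algebra to lists: a trilinear operation known on generators through [f] is
    computed on signed sums by [sbind3 f]. It serves for the brackets, the normal forms and the PATS
    alike. *)
Lemma signed_sum_trilinear (A B C D : Type) (q : V -> V -> V -> V)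
    (f : A -> B -> C -> seq (bool * D)) h1 h2 h3 h e1 e2 e3 :
  trilinear q ->
  (forall a b c, q (h1 a) (h2 b) (h3 c) = signed_sum h (f a b c)) ->
  q (signed_sum h1 e1) (signed_sum h2 e2) (signed_sum h3 e3) =
  signed_sum h (sbind3 f e1 e2 e3).
Proof.
case=> q1 q2 q3 qf; rewrite signed_sum_bind.
rewrite (@signed_sum_linear _ _ h1 (fun x => q x _ _)) //.
apply: signed_sum_eq => a /=; rewrite signed_sum_bind.
rewrite (@signed_sum_linear _ _ h2 (fun y => q _ y _)) //.
apply: signed_sum_eq => b /=; rewrite signed_sum_bind.
rewrite (@signed_sum_linear _ _ h3 (fun z => q _ _ z)) //.
by apply: signed_sum_eq => c /=.
Qed.

End SignedSum.

Lemma trilinear_add (V : lmodType rat) (p q : V -> V -> V -> V) :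
  trilinear p -> trilinear q -> trilinear (fun x y z => p x y z + q x y z).
Proof.
by case=> p1 p2 p3 [q1 q2 q3]; split=> u v; apply: linear_addf.
Qed.

Lemma trilinear_swap12 (V : lmodType rat) (p : V -> V -> V -> V) :
  trilinear p -> trilinear (fun x y z => p y x z).
Proof. by case=> p1 p2 p3; split=> u v //. Qed.

Lemma trilinear_swap23 (V : lmodType rat) (p : V -> V -> V -> V) :
  trilinear p -> trilinear (fun x y z => p x z y).
Proof. by case=> p1 p2 p3; split=> u v //. Qed.

(* Locked, like fdl and fdr below, because failed unifications would unfold it. *)
HB.lock Definition mon (K : choiceType) (k : K) : {malg rat[K]} := << k >>.

Lemma lext_mon (K : choiceType) (V : lmodType rat) (h : K -> V) k : lext h (mon k) = h k.
Proof. by rewrite mon.unlock lextU. Qed.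

Lemma fbr_mon (X : choiceType) (l c r : tmon X) :
  fbr (mon l) (mon c) (mon r) = mon (Node l c r).
Proof. by rewrite mon.unlock fbrU. Qed.

Lemma trilinear_ext (K : choiceType)
    (p q : {malg rat[K]} -> {malg rat[K]} -> {malg rat[K]} -> {malg rat[K]}) :
  trilinear p -> trilinear q ->
  (forall a b c, p (mon a) (mon b) (mon c) = q (mon a) (mon b) (mon c)) ->
  forall f g h, p f g h = q f g h.
Proof.
case=> p1 p2 p3 [q1 q2 q3] pq f g h.
move: f; apply: lext_ext => // a; move: g; apply: lext_ext => // b.
by move: h; apply: lext_ext => // c; move: pq; rewrite mon.unlock.
Qed.

Lemma eq_oppr0 (V : lmodType rat) (x : V) : x = - x -> x = 0.
Proof.
move=> xN; have: (2%:R : rat) *: x = 0 by rewrite scaler_nat mulr2n {2}xN subrr.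
by move/eqP; rewrite scaler_eq0 => /orP[|/eqP].
Qed.

(** * Normal forms of monomials *)

Section Order.
Variable n : nat.
Implicit Types x y z : tmon 'I_n.

(** Nodes precede leaves, because in straightened monomials the composite ones among alternating
    arguments stand before the leaves. Trees with composite roots are compared lexicographically. *)
Fixpoint tlt (x y : tmon 'I_n) : bool :=
  match x, y with
  | Leaf i, Leaf j => (i < j)%N
  | Leaf _, Node _ _ _ => false
  | Node _ _ _, Leaf _ => true
  | Node l c r, Node l' c' r' =>
      tlt l l' || (l == l') && (tlt c c' || (c == c') && tlt r r')
  end.

Lemma tlt_irr x : tlt x x = false.
Proof.
by elim: x => [i|l IHl c IHc r IHr] /=; rewrite ?ltnn // IHl IHc IHr !andbF.
Qed.

Lemma tlt_total x y : x != y -> tlt y x = ~~ tlt x y.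
Proof.
elim: x y => [i|l IHl c IHc r IHr] [j|l' c' r'] //=.
  move=> ij; rewrite -leqNgt [RHS]leq_eqVlt; case: eqP => // /ord_inj ji.
  by rewrite ji eqxx in ij.
case: (eqVneq l l') => [<-|ll'] /=; last by rewrite !orbF => _; apply: IHl.
rewrite tlt_irr /=; case: (eqVneq c c') => [<-|cc'] /=.
  rewrite tlt_irr /= => /eqP rr'; apply: IHr; apply/eqP => rr; apply: rr'.
  by rewrite rr.
by rewrite !orbF => _; apply: IHc.
Qed.

Lemma tlt_neq x y : tlt x y -> x != y.
Proof. by move=> xy; apply/eqP => E; rewrite E tlt_irr in xy. Qed.

Lemma tlt_trans : transitive tlt.
Proof.
move=> y x z; elim: y x z => [j|l IHl c IHc r IHr] [i|l1 c1 r1] [k|l2 c2 r2] //=.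
  exact: ltn_trans.
case/orP => [l1l|/andP[/eqP-> /orP[c1c|/andP[/eqP-> r1r]]]].
- case/orP => [ll2|/andP[/eqP<- _]]; last by rewrite l1l.
  by rewrite (IHl _ _ l1l ll2).
- case/orP => [ll2|/andP[/eqP<- /orP[cc2|/andP[/eqP<- _]]]].
  + by rewrite ll2.
  + by rewrite tlt_irr eqxx (IHc _ _ c1c cc2).
  + by rewrite tlt_irr eqxx c1c.
- case/orP => [->|/andP[/eqP<- /orP[->|/andP[/eqP<- rr2]]]] //.
    by rewrite tlt_irr eqxx.
  by rewrite !tlt_irr !eqxx (IHr _ _ r1r rr2).
Qed.

End Order.

Section NormalForms.
Variable n : nat.
Implicit Types l c r x y z m : tmon 'I_n.

Definition alt2 l c r : seq (bool * tmon 'I_n) :=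
  if c == r then [::]
  else if tlt c r then [:: (false, Node l c r)] else [:: (true, Node l r c)].

Definition alt3 x y z : seq (bool * tmon 'I_n) :=
  if [|| x == y, y == z | x == z] then [::] else
  [:: if tlt x y then
        if tlt y z then (false, Node x y z)
        else if tlt x z then (true, Node x z y) else (false, Node z x y)
      else
        if tlt x z then (true, Node y x z)
        else if tlt y z then (false, Node y z x) else (true, Node z y x)].

(** [inner] normalizes a subtree lying in a second or third slot, where all three arguments
    alternate. [outer] treats the root and the nodes reached from it through first slots only, where
    just the last two arguments alternate. *)
Fixpoint inner m : seq (bool * tmon 'I_n) :=
  match m with
  | Leaf _ => [:: (false, m)]
  | Node l c r => sbind3 alt3 (inner l) (inner c) (inner r)
  end.

Fixpoint outer m : seq (bool * tmon 'I_n) :=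
  match m with
  | Leaf _ => [:: (false, m)]
  | Node l c r => sbind3 alt2 (outer l) (inner c) (inner r)
  end.

Section Alternating.
Variable V : lmodType rat.
Implicit Type h : tmon 'I_n -> V.

Lemma signed_sum_alt2 h l c r :
  (forall l c r, h (Node l c r) = - h (Node l r c)) ->
  signed_sum h (alt2 l c r) = h (Node l c r).
Proof.
move=> hN; rewrite /alt2; case: (eqVneq c r) => [<-|cr].
  by rewrite signed_sum_nil (eq_oppr0 (hN l c c)).
by case: (tlt c r); rewrite signed_sum1 ?scale1r // scaleN1r -hN.
Qed.

Lemma signed_sum_alt3 h x y z :
  (forall x y z, h (Node x y z) = - h (Node y x z)) ->
  (forall x y z, h (Node x y z) = - h (Node x z y)) ->
  signed_sum h (alt3 x y z) = h (Node x y z).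
Proof.
move=> h12 h23; rewrite /alt3.
case: (eqVneq x y) => [<-|xy].
  by rewrite signed_sum_nil (eq_oppr0 (h12 x x z)).
case: (eqVneq y z) => [<-|yz].
  by rewrite signed_sum_nil (eq_oppr0 (h23 x y y)).
case: (eqVneq x z) => [<-|xz].
  by rewrite signed_sum_nil h12 (eq_oppr0 (h23 y x x)) oppr0.
rewrite signed_sum1.
case: (tlt x y); [case: (tlt y z); [|case: (tlt x z)]
                 |case: (tlt x z); [|case: (tlt y z)]];
  rewrite /= ?scale1r ?scaleN1r //.
- by rewrite [RHS]h23 [in RHS]h12 opprK.
- by rewrite [RHS]h12 [in RHS]h23 opprK.
- by rewrite [RHS]h12 [in RHS]h23 [in RHS]h12 opprK.
Qed.

(** Here [h] is arbitrary: the antisymmetry comes from the normal form itself. This is what makes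
    normalization kill the first defining identity. *)
Lemma alt2_swap h l c r :
  signed_sum h (alt2 l c r) + signed_sum h (alt2 l r c) = 0.
Proof.
rewrite /alt2 eq_sym; case: (eqVneq r c) => [_|rc].
  by rewrite signed_sum_nil addr0.
rewrite (tlt_total rc); case: (tlt r c); rewrite !signed_sum1 /=.
  by rewrite scaleN1r scale1r addNr.
by rewrite scaleN1r scale1r addrN.
Qed.

Lemma alt3_swap12 h x y z :
  signed_sum h (alt3 x y z) + signed_sum h (alt3 y x z) = 0.
Proof.
rewrite /alt3 (eq_sym y x) [(x == z) || _]orbC.
case: ifP => [_|]; first by rewrite signed_sum_nil addr0.
move/negbT; rewrite !negb_or => /and3P[xy yz xz].
rewrite (tlt_total xy).
by case: (tlt x y); case: (tlt y z); case: (tlt x z);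
  rewrite !signed_sum1 /= ?scaleN1r ?scale1r ?addNr ?addrN.
Qed.

Lemma alt3_swap23 h x y z :
  signed_sum h (alt3 x y z) + signed_sum h (alt3 x z y) = 0.
Proof.
rewrite /alt3 (eq_sym z y).
have -> : [|| x == z, y == z | x == y] = [|| x == y, y == z | x == z].
  by rewrite orbCA [(x == z) || _]orbC orbCA.
case: ifP => [_|]; first by rewrite signed_sum_nil addr0.
move/negbT; rewrite !negb_or => /and3P[xy yz xz].
rewrite (tlt_total yz).
(* [alt3] does not test all three comparisons on every branch. Two of the eight outcomes fail to
   cancel, and transitivity excludes them. *)
have t1 := @tlt_trans _ y x z; have t2 := @tlt_trans _ z x y.
have {}t2 : tlt x z -> ~~ tlt y z -> tlt x y.
  by rewrite -(tlt_total yz); apply: t2.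
case exy: (tlt x y) t1 t2; case eyz: (tlt y z); case exz: (tlt x z) => t1 t2;
  rewrite !signed_sum1 /= ?scaleN1r ?scale1r ?addNr ?addrN //.
- by have := t1 isT isT.
- by have := t2 isT isT.
Qed.

End Alternating.

(** * Normal forms represent the same class in the free algebra *)

Definition pi_mon m : free_pata 'I_n := pi_pata (mon m).

Lemma pi_mon_leaf i : pi_mon (Leaf i) = gen i.
Proof. by rewrite /pi_mon mon.unlock. Qed.

Lemma pi_mon_node l c r : pi_mon (Node l c r) = br (pi_mon l) (pi_mon c) (pi_mon r).
Proof. by rewrite br_pi fbr_mon. Qed.

Lemma br_swap23 (u v w : free_pata 'I_n) : br u v w = - br u w v.
Proof. by apply/eqP; rewrite -addr_eq0; apply/eqP; apply: (br_pata _).1. Qed.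

Lemma br_swap12 (u x y z w : free_pata 'I_n) :
  br u (br x y z) w = - br u (br y x z) w.
Proof. by apply/eqP; rewrite -addr_eq0; apply/eqP; apply: (br_pata _).2. Qed.

Lemma br_inner_trilinear (u w : free_pata 'I_n) :
  trilinear (fun p q r : free_pata 'I_n => br u (br p q r) w).
Proof.
have [b1 b2 b3] := br_trilinear 'I_n.
by split=> x y k v t; rewrite ?b1 ?b3 !b2.
Qed.

(** Inside a second slot the node's arguments alternate, so each of them can be moved to a second
    slot of its own bracket, normalized there by induction, and moved back. *)
Lemma br_inner m u w : br u (pi_mon m) w = br u (signed_sum pi_mon (inner m)) w.
Proof.
have [b1 b2 b3] := br_trilinear 'I_n.
elim: m u w => [i|l IHl c IHc r IHr] u w; first by rewrite signed_sum1 scale1r.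
rewrite pi_mon_node br_swap12 IHl -br_swap12.
rewrite [br (signed_sum _ _) _ _]br_swap23 IHr -br_swap23 IHc.
(* Full alternation holds only within a slot of an outer bracket, so the trilinear map expanded here
   is [br u (br p q r) w] in [p], [q], [r]. *)
rewrite (signed_sum_trilinear (f := alt3) (h := fun t => br u (pi_mon t) w)
  _ _ _ (br_inner_trilinear u w)); last first.
  move=> x y z; rewrite -pi_mon_node; apply/esym/signed_sum_alt3 => {}x {}y {}z.
    by rewrite !pi_mon_node br_swap12.
  by rewrite !pi_mon_node [br (pi_mon x) _ _]br_swap23 (linear_funN (b2 u w)).
by rewrite [RHS](signed_sum_linear _ _ (b2 u w)).
Qed.

Lemma pi_mon_outer m : pi_mon m = signed_sum pi_mon (outer m).
Proof.
elim: m => [i|l IHl c _ r _]; first by rewrite signed_sum1 scale1r.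
rewrite pi_mon_node {1}IHl br_inner br_swap23 br_inner -br_swap23.
rewrite (signed_sum_trilinear (f := alt2) (h := pi_mon) _ _ _ (br_trilinear _)) //.
move=> x y z; rewrite -pi_mon_node signed_sum_alt2 // => {}x {}y {}z.
by rewrite !pi_mon_node br_swap23.
Qed.

(** * Normalization as a linear map on the free ternary algebra *)

Definition basis_ext3 (F : tmon 'I_n -> tmon 'I_n -> tmon 'I_n -> free_ternary 'I_n)
    (f g h : free_ternary 'I_n) : free_ternary 'I_n :=
  lext (fun a => lext (fun b => lext (F a b) h) g) f.

Lemma basis_ext3_trilinear F : trilinear (basis_ext3 F).
Proof.
rewrite /basis_ext3; split=> [y z|x z|x y]; first exact: lext_linear.
  by apply: lext_paraml => k; apply: lext_linear.
by apply: lext_paraml => k; apply: lext_paraml => k'; apply: lext_linear.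
Qed.

Lemma basis_ext3U F a b c : basis_ext3 F (mon a) (mon b) (mon c) = F a b c.
Proof. by rewrite /basis_ext3 !lext_mon. Qed.

Definition alt2_ext := basis_ext3 (fun l c r => signed_sum (@mon _) (alt2 l c r)).
Definition alt3_ext := basis_ext3 (fun x y z => signed_sum (@mon _) (alt3 x y z)).
Definition outer_ext (f : free_ternary 'I_n) : free_ternary 'I_n :=
  lext (fun m => signed_sum (@mon _) (outer m)) f.
Definition inner_ext (f : free_ternary 'I_n) : free_ternary 'I_n :=
  lext (fun m => signed_sum (@mon _) (inner m)) f.

Lemma outer_ext_linear : linear outer_ext. Proof. exact: lext_linear. Qed.
Lemma inner_ext_linear : linear inner_ext. Proof. exact: lext_linear. Qed.

Local Notation FT := (free_ternary 'I_n).

Lemma trilinear_comp (q : FT -> FT -> FT -> FT) (f g h : FT -> FT) :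
  trilinear q -> linear f -> linear g -> linear h ->
  trilinear (fun u v w : FT => q (f u) (g v) (h w)).
Proof.
by case=> q1 q2 q3 lf lg lh; split=> u v k x y; rewrite ?lf ?lg ?lh ?q1 ?q2 ?q3.
Qed.

Lemma comp_trilinear (q : FT -> FT -> FT -> FT) (f : FT -> FT) :
  trilinear q -> linear f -> trilinear (fun u v w : FT => f (q u v w)).
Proof.
by case=> q1 q2 q3 lf; split=> u v k x y; rewrite ?q1 ?q2 ?q3 lf.
Qed.

(** The normal form of a bracket depends only on the normal forms of its arguments, so vanishing of
    the latter passes to the former. *)
Lemma outer_ext_fbr f g h :
  outer_ext (fbr f g h) = alt2_ext (outer_ext f) (inner_ext g) (inner_ext h).
Proof.
move: f g h; apply: trilinear_ext.
- by apply: comp_trilinear outer_ext_linear; apply: fbr_trilinear.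
- apply: trilinear_comp; [exact: basis_ext3_trilinear| | |];
    [exact: outer_ext_linear | exact: inner_ext_linear | exact: inner_ext_linear].
move=> a b c; rewrite fbr_mon /outer_ext /inner_ext /alt2_ext !lext_mon /=.
rewrite (signed_sum_trilinear (f := @alt2) (h := @mon _) _ _ _
  (basis_ext3_trilinear _)) //.
by move=> *; rewrite basis_ext3U.
Qed.

Lemma inner_ext_fbr f g h :
  inner_ext (fbr f g h) = alt3_ext (inner_ext f) (inner_ext g) (inner_ext h).
Proof.
move: f g h; apply: trilinear_ext.
- by apply: comp_trilinear inner_ext_linear; apply: fbr_trilinear.
- apply: trilinear_comp; [exact: basis_ext3_trilinear| | |]; exact: inner_ext_linear.
move=> a b c; rewrite fbr_mon /inner_ext /alt3_ext !lext_mon /=.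
rewrite (signed_sum_trilinear (f := @alt3) (h := @mon _) _ _ _
  (basis_ext3_trilinear _)) //.
by move=> *; rewrite basis_ext3U.
Qed.

Lemma trilinear0 : trilinear (fun _ _ _ : FT => 0 : FT).
Proof. by split=> u v k x y; rewrite scaler0 addr0. Qed.

Lemma alt2_ext_swap f g h : alt2_ext f g h + alt2_ext f h g = 0.
Proof.
move: f g h; apply: (trilinear_ext (p := fun f g h => alt2_ext f g h + alt2_ext f h g)
  (q := fun _ _ _ => 0)); [|exact: trilinear0|].
  apply: trilinear_add; first exact: basis_ext3_trilinear.
  by apply: trilinear_swap23; apply: basis_ext3_trilinear.
by move=> a b c; rewrite /alt2_ext !basis_ext3U alt2_swap.
Qed.

Lemma alt3_ext_swap12 f g h : alt3_ext f g h + alt3_ext g f h = 0.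
Proof.
move: f g h; apply: (trilinear_ext (p := fun f g h => alt3_ext f g h + alt3_ext g f h)
  (q := fun _ _ _ => 0)); [|exact: trilinear0|].
  apply: trilinear_add; first exact: basis_ext3_trilinear.
  by apply: trilinear_swap12; apply: basis_ext3_trilinear.
by move=> a b c; rewrite /alt3_ext !basis_ext3U alt3_swap12.
Qed.

Lemma alt3_ext_swap23 f g h : alt3_ext f g h + alt3_ext f h g = 0.
Proof.
move: f g h; apply: (trilinear_ext (p := fun f g h => alt3_ext f g h + alt3_ext f h g)
  (q := fun _ _ _ => 0)); [|exact: trilinear0|].
  apply: trilinear_add; first exact: basis_ext3_trilinear.
  by apply: trilinear_swap23; apply: basis_ext3_trilinear.
by move=> a b c; rewrite /alt3_ext !basis_ext3U alt3_swap23.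
Qed.

(** The two maps are treated together, since [outer_ext] of a bracket involves [inner_ext] of its
    second and third arguments. *)
Lemma outer_ext_cons f : pata_cons f -> outer_ext f = 0 /\ inner_ext f = 0.
Proof.
have [a1 a2 a3] : trilinear alt2_ext := basis_ext3_trilinear _.
have [b1 b2 b3] : trilinear alt3_ext := basis_ext3_trilinear _.
have OD := linear_funD outer_ext_linear; have ID := linear_funD inner_ext_linear.
elim=> {f} [x y z|v w x y z||f g _ [of0 if0] _ [og ig]|c f _ [of0 if0]
  |f y z _ [of0 if0]|x f z _ [of0 if0]|x y f _ [of0 if0]].
- by rewrite OD ID !outer_ext_fbr !inner_ext_fbr alt2_ext_swap alt3_ext_swap23.
- rewrite OD ID !outer_ext_fbr !inner_ext_fbr -(linear_funD (a2 _ _)) -(linear_funD (b2 _ _)).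
  by rewrite alt3_ext_swap12 (linear_fun0 (a2 _ _)) (linear_fun0 (b2 _ _)).
- by rewrite (linear_fun0 outer_ext_linear) (linear_fun0 inner_ext_linear).
- by rewrite OD ID of0 if0 og ig addr0.
- by rewrite (linear_funZ outer_ext_linear) (linear_funZ inner_ext_linear) of0 if0 !scaler0.
- by rewrite outer_ext_fbr inner_ext_fbr of0 if0 (linear_fun0 (a1 _ _)) (linear_fun0 (b1 _ _)).
- by rewrite outer_ext_fbr inner_ext_fbr if0 (linear_fun0 (a2 _ _)) (linear_fun0 (b2 _ _)).
- by rewrite outer_ext_fbr inner_ext_fbr if0 (linear_fun0 (a3 _ _)) (linear_fun0 (b3 _ _)).
Qed.

(** * Monomials in normal form *)

Fixpoint is_inner m : bool :=
  if m is Node x y z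
  then [&& is_inner x, is_inner y, is_inner z, tlt x y & tlt y z] else true.

Fixpoint is_outer m : bool :=
  if m is Node l c r then [&& is_outer l, is_inner c, is_inner r & tlt c r] else true.

Lemma inner_id m : is_inner m -> inner m = [:: (false, m)].
Proof.
elim: m => //= x IHx y IHy z IHz /and5P[ix iy iz xy yz].
rewrite IHx // IHy // IHz // /sbind3 /sbind /alt3 /= !cats0.
by rewrite !(negPf (tlt_neq _)) ?xy ?yz //; apply: tlt_trans yz.
Qed.

Lemma outer_id m : is_outer m -> outer m = [:: (false, m)].
Proof.
elim: m => //= l IHl c _ r _ /and4P[ol ic ir cr].
by rewrite IHl // !inner_id // /sbind3 /sbind /alt2 /= !cats0 (negPf (tlt_neq cr)) cr.
Qed.

Lemma sbind_all (A B : Type) (P : pred A) (Q : pred B) e (f : A -> seq (bool * B)) :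
  all (P \o snd) e -> (forall a, P a -> all (Q \o snd) (f a)) ->
  all (Q \o snd) (sbind e f).
Proof.
move=> Pe PQ; elim: e Pe => //= t e IH /andP[Pt Pe].
by rewrite all_cat IH // all_map andbT; apply: PQ.
Qed.

(** The leaves are recorded too: normalization preserves the content of a monomial, hence keeps the
    component of a given multidegree. *)
Definition inner_of m : pred (tmon 'I_n) :=
  fun t => is_inner t && perm_eq (leaves t) (leaves m).
Definition outer_of m : pred (tmon 'I_n) :=
  fun t => is_outer t && perm_eq (leaves t) (leaves m).

Lemma inner_normal m : all (inner_of m \o snd) (inner m).
Proof.
elim: m => [i|x IHx y IHy z IHz] /=; first by rewrite /inner_of /= perm_refl.
apply: (sbind_all IHx) => x' /andP[ix px].
apply: (sbind_all IHy) => y' /andP[iy py].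
apply: (sbind_all IHz) => z' /andP[iz pz].
rewrite /alt3; case: ifP => // /negbT; rewrite !negb_or => /and3P[xy yz xz].
have p : perm_eq (leaves x' ++ leaves y' ++ leaves z') (leaves x ++ leaves y ++ leaves z).
  by rewrite !perm_cat.
have t1 := tlt_total xy; have t2 := tlt_total yz; have t3 := tlt_total xz.
rewrite /= andbT /inner_of -(permPr p).
(* These are the five nontrivial rearrangements of the arguments that [alt3] can produce. *)
have q (s1 s2 s3 : seq 'I_n) : [/\ perm_eq (s1 ++ s3 ++ s2) (s1 ++ s2 ++ s3),
    perm_eq (s2 ++ s1 ++ s3) (s1 ++ s2 ++ s3), perm_eq (s2 ++ s3 ++ s1) (s1 ++ s2 ++ s3),
    perm_eq (s3 ++ s1 ++ s2) (s1 ++ s2 ++ s3) & perm_eq (s3 ++ s2 ++ s1) (s1 ++ s2 ++ s3)].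
  split; apply/seq.permP => a; rewrite !count_cat.
  - by rewrite (addnC (count a s3)).
  - by rewrite addnCA.
  - by rewrite addnA addnC.
  - by rewrite addnC addnA.
  - by rewrite addnA addnC (addnC (count a s3)).
have [q1 q2 q3 q4 q5] := q (leaves x') (leaves y') (leaves z').
by case e1: (tlt x' y') t1 => t1; case e2: (tlt y' z') t2 => t2;
 case e3: (tlt x' z') t3 => t3; rewrite /= ix iy iz ?e1 ?e2 ?e3 ?t1 ?t2 ?t3 //=.
Qed.

Lemma outer_normal m : all (outer_of m \o snd) (outer m).
Proof.
elim: m => [i|x IHx y _ z _] /=; first by rewrite /outer_of /= perm_refl.
apply: (sbind_all IHx) => x' /andP[ix px].
apply: (sbind_all (inner_normal y)) => y' /andP[iy py].
apply: (sbind_all (inner_normal z)) => z' /andP[iz pz].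
rewrite /alt2; case: (eqVneq y' z') => // yz.
have p : perm_eq (leaves x' ++ leaves y' ++ leaves z') (leaves x ++ leaves y ++ leaves z).
  by rewrite !perm_cat.
have := tlt_total yz.
case e: (tlt y' z') => t; rewrite /= /outer_of /= ix iy iz ?e ?t /= ?andbT -?(permPr p) //.
by rewrite perm_cat2l perm_catC.
Qed.

Fixpoint nodes m : nat :=
  if m is Node l c r then (nodes l + nodes c + nodes r).+1 else 0%N.

Lemma size_leaves m : size (leaves m) = (nodes m).*2.+1.
Proof.
elim: m => //= l IHl c IHc r IHr; rewrite !size_cat IHl IHc IHr.
by rewrite /= doubleS !doubleD !addnS !addSn addnA.
Qed.

Lemma eq_leaf (i j : 'I_n) : (Leaf i == Leaf j :> tmon 'I_n) = (i == j).
Proof. by apply/eqP/eqP => [[]|->]. Qed.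

(** Degree 7 means exactly three nodes, which leaves finitely many tree shapes to inspect. *)
Lemma straightened7E m : straightened7 m = (size (leaves m) == 7) && is_outer m.
Proof.
rewrite size_leaves; have -> : ((nodes m).*2.+1 == 7) = (nodes m == 3%N).
  by rewrite -[RHS](inj_eq double_inj).
case: eqP => H /=.
  repeat match goal with t : tmon _ |- _ =>
    (* Trees are opened as long as the node count permits; an excess or a lack of nodes contradicts
       [H]. *)
    destruct t; simpl in H; rewrite ?(addSn, addnS, add0n, addn0) in H;
    try discriminate H end.
all: rewrite /= ?eq_leaf ?andbT ?andbF ?andbA //.
apply/negP => s7; apply: H; move: s7.
by rewrite /straightened7; repeat (match goal with
  |- context [match ?t with Leaf _ => _ | Node _ _ _ => _ end] =>
    is_var t; destruct t end; try done).
Qed.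

End NormalForms.

(** * Expansion in dialgebras *)

(* (u, x, w) stands for u |- x -| w. *)
Definition word (X : Type) : Type := (seq X * X * seq X)%type.

Section Words.
Variable X : Type.
Implicit Types p q r : word X.

(** The products of the free dialgebra: both concatenate, one keeping the centre of the left factor
    and the other that of the right factor. *)
Definition wdl p q : word X := (p.1.1, p.1.2, p.2 ++ q.1.1 ++ q.1.2 :: q.2).
Definition wdr p q : word X := (p.1.1 ++ p.1.2 :: p.2 ++ q.1.1, q.1.2, q.2).

Definition wpats p q r : seq (bool * word X) :=
  [:: (false, wdl (wdl p q) r); (true, wdl (wdl p r) q);
      (true, wdl (wdr q p) r); (false, wdl (wdr r p) q);
      (false, wdr (wdr q r) p); (true, wdr (wdr r q) p)].

Fixpoint expand (m : tmon X) : seq (bool * word X) :=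
  match m with
  | Leaf x => [:: (false, ([::], x, [::]))]
  | Node l c r => sbind3 wpats (expand l) (expand c) (expand r)
  end.

Lemma wdlA p q r : wdl (wdl p q) r = wdl p (wdl q r).
Proof. by rewrite /wdl /= -!catA. Qed.

Lemma wdrA p q r : wdr (wdr p q) r = wdr p (wdr q r).
Proof. by rewrite /wdr /= -!catA /= -!catA. Qed.

Lemma wdlrA p q r : wdl (wdr p q) r = wdr p (wdl q r).
Proof. by []. Qed.

Lemma wdr_bar p q r : wdr (wdl p q) r = wdr (wdr p q) r.
Proof. by rewrite /wdr /wdl /= -!catA /= -!catA. Qed.

Lemma wdl_bar p q r : wdl p (wdl q r) = wdl p (wdr q r).
Proof. by rewrite /wdr /wdl /= -!catA /= -!catA. Qed.

End Words.

Section Value.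
Variables (X : choiceType) (D : dialgebra) (v : X -> D).
Implicit Types p q r : word X.

Definition dlfold (t : D) (s : seq X) : D := foldl (fun t y => dl t (v y)) t s.
Definition drfold (s : seq X) (t : D) : D := foldr (fun y t => dr (v y) t) t s.
Definition wval p : D := drfold p.1.1 (dlfold (v p.1.2) p.2).

Lemma dl_drfold s t t' : dl (drfold s t) t' = drfold s (dl t t').
Proof. by elim: s => //= y s <-; rewrite dlr_assoc. Qed.

(** In the right factor of [dl] the two products agree, so the letters before the centre of that
    factor are absorbed one by one. [dr_dlfold] is the mirror image. *)
Lemma dl_drfoldr s t t' : dl t' (drfold s t) = dl (dlfold t' s) t.
Proof. by elim: s t' => //= y s IH t'; rewrite -dl_bar -dl_assoc IH. Qed.

Lemma dl_dlfold s t t' : dl t' (dlfold t s) = dlfold (dl t' t) s.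
Proof. by elim: s t => //= y s IH t; rewrite IH dl_assoc. Qed.

Lemma dr_drfold s t t' : dr (drfold s t) t' = drfold s (dr t t').
Proof. by elim: s => //= y s <-; rewrite dr_assoc. Qed.

Lemma dr_dlfold s t t' : dr (dlfold t s) t' = dr t (drfold s t').
Proof. by elim: s t => //= y s IH t; rewrite IH dr_bar dr_assoc. Qed.

Lemma wval_dl p q : wval (wdl p q) = dl (wval p) (wval q).
Proof.
rewrite /wval dl_drfold dl_drfoldr dl_dlfold /= /dlfold.
by rewrite !foldl_cat.
Qed.

Lemma wval_dr p q : wval (wdr p q) = dr (wval p) (wval q).
Proof.
rewrite /wval dr_drfold dr_dlfold /= /drfold.
by rewrite !foldr_cat /= foldr_cat.
Qed.

Lemma pats_wval p q r :
  pats (wval p) (wval q) (wval r) = signed_sum wval (wpats p q r).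
Proof.
rewrite !signed_sum_cons signed_sum_nil /= !scaleN1r !scale1r !(wval_dl, wval_dr).
by rewrite addr0 /pats !addrA.
Qed.

(** The expansion is valid in every dialgebra; cancellation of words therefore proves an identity of
    the PATS. *)
Lemma mon_eval_expand m : mon_eval v m = signed_sum wval (expand m).
Proof.
elim: m => [x|l IHl c IHc r IHr] /=; first by rewrite signed_sum1 scale1r.
by rewrite IHl IHc IHr (signed_sum_trilinear _ _ _ (pats_trilinear D) pats_wval).
Qed.

End Value.

(** * The free dialgebra *)

HB.lock Definition fdl (X : choiceType) (f g : {malg rat[word X]}) :
    {malg rat[word X]} :=
  lext (fun p => lext (fun q => mon (wdl p q)) g) f.

HB.lock Definition fdr (X : choiceType) (f g : {malg rat[word X]}) :
    {malg rat[word X]} :=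
  lext (fun p => lext (fun q => mon (wdr p q)) g) f.

Section FreeDialgebra.
Variable X : choiceType.
Notation F := {malg rat[word X]}.
Local Notation fdl := (@fdl X).
Local Notation fdr := (@fdr X).

Fact fdl_bilinear : bilinear_for *:%R *:%R fdl.
Proof.
rewrite fdl.unlock; split=> [g k x y|f]; first exact: lext_linear.
by apply: lext_paraml => p; apply: lext_linear.
Qed.

Fact fdr_bilinear : bilinear_for *:%R *:%R fdr.
Proof.
rewrite fdr.unlock; split=> [g k x y|f]; first exact: lext_linear.
by apply: lext_paraml => p; apply: lext_linear.
Qed.

HB.instance Definition _ := bilinear_isBilinear.Build rat _ _ _ _ _ fdl fdl_bilinear.
HB.instance Definition _ := bilinear_isBilinear.Build rat _ _ _ _ _ fdr fdr_bilinear.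

Lemma fdlU p q : fdl (mon p) (mon q) = mon (wdl p q).
Proof. by rewrite fdl.unlock !lext_mon. Qed.

Lemma fdrU p q : fdr (mon p) (mon q) = mon (wdr p q).
Proof. by rewrite fdr.unlock !lext_mon. Qed.

Lemma bilinear_compl (p q : {bilinear F -> F -> F}) :
  trilinear (fun f g h => p (q f g) h).
Proof. by split=> f g k x y; rewrite ?linearPl ?linearPr ?linearPl. Qed.

Lemma bilinear_compr (p q : {bilinear F -> F -> F}) :
  trilinear (fun f g h => p f (q g h)).
Proof. by split=> f g k x y; rewrite ?linearPl ?linearPr ?linearPl ?linearPr. Qed.

Fact fdl_assoc f g h : fdl (fdl f g) h = fdl f (fdl g h).
Proof.
move: f g h; apply: trilinear_ext => [||a b c].
- exact: bilinear_compl.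
- exact: bilinear_compr.
by rewrite !fdlU wdlA.
Qed.

Fact fdr_assoc f g h : fdr (fdr f g) h = fdr f (fdr g h).
Proof.
move: f g h; apply: trilinear_ext => [||a b c].
- exact: bilinear_compl.
- exact: bilinear_compr.
by rewrite !fdrU wdrA.
Qed.

Fact fdlr_assoc f g h : fdl (fdr f g) h = fdr f (fdl g h).
Proof.
move: f g h; apply: trilinear_ext => [||a b c].
- exact: bilinear_compl.
- exact: bilinear_compr.
by rewrite fdrU !fdlU fdrU wdlrA.
Qed.

Fact fdr_bar f g h : fdr (fdl f g) h = fdr (fdr f g) h.
Proof.
move: f g h; apply: trilinear_ext => [||a b c].
- exact: bilinear_compl.
- exact: bilinear_compl.
by rewrite fdlU !fdrU wdr_bar.
Qed.

Fact fdl_bar f g h : fdl f (fdl g h) = fdl f (fdr g h).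
Proof.
move: f g h; apply: trilinear_ext => [||a b c].
- exact: bilinear_compr.
- exact: bilinear_compr.
by rewrite fdrU !fdlU wdl_bar.
Qed.

Definition free_dialgebra : dialgebra :=
  Dialgebra fdl_assoc fdr_assoc fdlr_assoc fdr_bar fdl_bar.

Definition free_dialg_gen (x : X) : free_dialgebra :=
  mon ([::], x, [::]).

(** Distinct words become distinct basis elements, so an element vanishing in this dialgebra has
    every word coefficient equal to zero. *)
Lemma wval_free p : wval free_dialg_gen p = mon p :> F.
Proof.
case: p => [[s x] t]; rewrite /wval /=.
have dlf t' : dlfold free_dialg_gen (mon ([::], x, t') : F) t =
    mon ([::], x, t' ++ t) :> F.
  elim: t t' => [|y t IH] t'; first by rewrite cats0.
  rewrite -[LHS]/(dlfold free_dialg_gen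
    (fdl (mon ([::], x, t')) (mon ([::], y, [::]))) t).
  by rewrite fdlU /wdl /= IH -catA.
rewrite dlf cat0s; elim: s => [//|y s IH].
by rewrite -[LHS]/(fdr (mon ([::], y, [::])) (drfold free_dialg_gen s _)) IH fdrU.
Qed.

End FreeDialgebra.

(** * Sums over permutations *)

(** Permutations as lists of images, built by choosing the image [j] of 0 and shifting the remaining
    images past [j]. The choice adds [j] inversions, hence the sign [odd j]. *)
Fixpoint sperms (n : nat) : seq (bool * seq nat) :=
  if n is n'.+1 then
    flatten [seq [seq (odd j (+) t.1, j :: map (bump j) t.2) | t <- sperms n']
            | j <- iota 0 n]
  else [:: (false, [::])].

Lemma lift_perm_inj n (i j : 'I_n.+1) : injective (@lift_perm n i j).
Proof.
move=> s t st; apply/permP => k; apply: (@lift_inj _ j).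
by rewrite -(lift_perm_lift i) st lift_perm_lift.
Qed.

Lemma lift_perm_surj n (i : 'I_n.+1) (s : 'S_n.+1) :
  exists t, s = lift_perm i (s i) t.
Proof.
have sN k : s i != s (lift i k) by rewrite (inj_eq perm_inj) neq_lift.
(* The default [k] is never returned, as [s (lift i k)] differs from [s i]. *)
pose f k := odflt k (unlift (s i) (s (lift i k))).
have fE k : lift (s i) (f k) = s (lift i k).
  by rewrite /f; case: (unlift_some (sN k)) => k' -> ->.
have f_inj : injective f.
  by move=> k k' E; apply: (@lift_inj _ i); apply: (@perm_inj _ s); rewrite -!fE E.
exists (perm f_inj); apply/permP => k; case: (unliftP i k) => [k' ->|->].
  by rewrite lift_perm_lift permE fE.
by rewrite lift_perm_id.
Qed.

(** The permutations are grouped by the image [j] of 0; those in one group are the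
    [lift_perm ord0 j t], with sign [odd j] times the sign of [t]. *)
Lemma sum_perms n (V : lmodType rat) (G : seq nat -> V) :
  \sum_(s : 'S_n) (-1) ^+ s *: G [seq val (s i) | i <- enum 'I_n] =
  signed_sum G (sperms n).
Proof.
elim: n G => [|n IH] G.
  rewrite (big_pred1 (1%g : 'S_0)) => [|s]; last by apply/esym/eqP/permP => -[].
  by rewrite odd_perm1 signed_sum1 (size0nil (size_enum_ord 0)).
rewrite (partition_big (fun s : 'S_n.+1 => s ord0) predT) //.
rewrite /signed_sum [sperms _]/sperms -/sperms big_flatten big_map.
rewrite -[iota 0 n.+1]val_enum_ord big_map big_enum /=.
apply: eq_bigr => j _; rewrite big_map.
transitivity (\sum_(t : 'S_n) (-1) ^+ (odd j (+) t) *: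
    G (val j :: map (bump j) [seq val (t i) | i <- enum 'I_n])).
  rewrite (reindex (lift_perm ord0 j)) /=; last first.
    (* The inverse is found by search; the default is not reached when [s] sends 0 to [j]. *)
    exists (fun s => odflt (1%g : 'S_n) [pick t | lift_perm ord0 j t == s]) => [t _|s].
      case: pickP => [t' /eqP/lift_perm_inj //|/(_ t)]; by rewrite eqxx.
    rewrite inE => /eqP sj; case: pickP => [t' /eqP //|].
    by have [t st] := lift_perm_surj ord0 s; move/(_ t); rewrite -sj -st eqxx.
  apply: eq_big => [t|t _]; first by rewrite lift_perm_id eqxx.
  rewrite odd_lift_perm /= enum_ordSl /= lift_perm_id; congr (_ *: G (_ :: _)).
  by rewrite -!map_comp; apply: eq_map => k /=; rewrite lift_perm_lift.
transitivity ((-1) ^+ odd j *: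
    signed_sum (fun l => G (val j :: map (bump j) l)) (sperms n)).
  rewrite -IH scaler_sumr; apply: eq_bigr => t _.
  by rewrite signr_addb scalerA.
rewrite scaler_sumr; apply: eq_bigr => t _.
by rewrite signr_addb scalerA.
Qed.

(** * Integer elimination *)

(** Fraction-free elimination of the entry in column [k]; [primitive] then divides by the gcd of the
    entries to keep the integers small. *)
Definition row_sub (k : nat) (p r : seq int) : seq int :=
  let a := p`_k in let b := r`_k in [seq a * t.1 - b * t.2 | t <- zip r p].

Definition content (r : seq int) : nat :=
  foldr (fun x g => gcdn `|x|%N g) 0%N r.

Definition primitive (r : seq int) : seq int :=
  let g := (content r)%:Z in [seq (x %/ g)%Z | x <- r].

Definition reduce (pivots : seq (nat * seq int)) (r : seq int) : seq int :=
  foldl (fun r t => if r`_t.1 == 0 then r else row_sub t.1 t.2 r) r pivots.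

(** A row reduced to zero receives its own size as pivot column. There [nth] returns the default 0,
    so later steps skip it. *)
Fixpoint echelon (pivots : seq (nat * seq int)) (rows : seq (seq int)) :=
  if rows is r :: rows' then
    let r' := primitive (reduce pivots r) in
    echelon (rcons pivots (find (fun x => x != 0) r', r')) rows'
  else pivots.

Definition row_support (r : seq int) : seq nat :=
  [seq i <- iota 0 (size r) | r`_i != 0].

(* The rows are used from the last to the first: in echelon form the last row
   has the fewest unknowns left. *)
Fixpoint propagate (zeros : seq nat) (pivots : seq (nat * seq int)) : seq nat :=
  if pivots is (k, r) :: pivots' then
    let zeros' := propagate zeros pivots' in
    if (r`_k != 0) && all (fun i => (i == k) || (i \in zeros')) (row_support r)
    then k :: zeros' else zeros'
  else zeros.

Section Elimination.
Variables (n : nat) (c : nat -> rat).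

Definition annihilates (r : seq int) : Prop :=
  size r = n /\ \sum_(i < n) (r`_i)%:~R * c i = 0.

Lemma annihilates_row_sub k p r :
  annihilates p -> annihilates r -> annihilates (row_sub k p r).
Proof.
move=> [sp p0] [sr r0]; split; first by rewrite size_map size_zip sp sr minnn.
transitivity ((p`_k)%:~R * (\sum_(i < n) (r`_i)%:~R * c i) -
    (r`_k)%:~R * (\sum_(i < n) (p`_i)%:~R * c i)); last by rewrite r0 p0 !mulr0 subrr.
rewrite !mulr_sumr -sumrB; apply: eq_bigr => i _.
rewrite (nth_map (0, 0)) ?size_zip ?sp ?sr ?minnn //.
by rewrite nth_zip ?sp ?sr //= rmorphB !rmorphM mulrBl !mulrA.
Qed.

Lemma dvdn_content r x : x \in r -> (content r %| `|x|)%N.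
Proof.
elim: r => //= y r IH; rewrite inE => /predU1P[->|/IH]; first exact: dvdn_gcdl.
by apply: dvdn_trans; apply: dvdn_gcdr.
Qed.

Lemma annihilates_primitive r : annihilates r -> annihilates (primitive r).
Proof.
move=> [sr r0]; split; first by rewrite size_map.
have [g0|g0] := eqVneq (content r) 0%N.
  (* Division by a content equal to 0 yields 0, so the new row is zero. *)
  apply: big1 => i _; rewrite (nth_map 0) ?sr // g0 divz0.
  by rewrite mul0r.
have: (content r)%:R * (\sum_(i < n) ((primitive r)`_i)%:~R * c i) = 0 :> rat.
  rewrite -[RHS]r0 mulr_sumr; apply: eq_bigr => i _.
  rewrite (nth_map 0) ?sr // mulrA; congr (_ * _).
  rewrite -[_%:R]/((content r)%:Z%:~R) -rmorphM /= mulrC divzK //.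
  by apply: dvdn_content; rewrite mem_nth ?sr.
by move/eqP; rewrite mulf_eq0 pnatr_eq0 (negPf g0) => /eqP.
Qed.

Lemma annihilates_reduce pivots r :
  (forall t, t \in pivots -> annihilates t.2) ->
  annihilates r -> annihilates (reduce pivots r).
Proof.
rewrite /reduce; elim: pivots r => //= t pivots IH r Hp Hr; apply: IH.
  by move=> u up; apply: Hp; rewrite inE up orbT.
by case: ifP => // _; apply: annihilates_row_sub => //; apply: Hp; rewrite mem_head.
Qed.

Lemma annihilates_echelon pivots rows :
  (forall t, t \in pivots -> annihilates t.2) ->
  (forall r, r \in rows -> annihilates r) ->
  forall t, t \in echelon pivots rows -> annihilates t.2.
Proof.
elim: rows pivots => //= r rows IH pivots Hp Hr; apply: IH => [t|r' r'r].
  rewrite mem_rcons inE => /predU1P[->|/Hp //] /=.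
  by apply/annihilates_primitive/annihilates_reduce => //; apply: Hr; rewrite mem_head.
by apply: Hr; rewrite inE r'r orbT.
Qed.

Lemma propagate_zeros zeros pivots :
  (forall t, t \in pivots -> annihilates t.2) ->
  (forall i, i \in zeros -> c i = 0) ->
  forall i, i \in propagate zeros pivots -> c i = 0.
Proof.
elim: pivots => //= -[k r] pivots IH Hp Hz.
have {}IH : forall i, i \in propagate zeros pivots -> c i = 0.
  by apply: IH => // t tp; apply: Hp; rewrite inE tp orbT.
case: ifP => // /andP[rk /allP sr] i; rewrite inE => /predU1P[->|/IH //].
have /= [szr r0] := Hp (k, r) (mem_head _ _).
have kn : (k < n)%N.
  by rewrite -szr ltnNge; apply: contra rk => /(nth_default 0) ->.
move: r0; rewrite (bigD1 (Ordinal kn)) //= big1 ?addr0 => [/eqP|j jk].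
  by rewrite mulf_eq0 intr_eq0 (negPf rk) => /eqP.
have [->|rj] := eqVneq r`_j 0; first by rewrite mul0r.
have /sr : (val j) \in row_support r by rewrite mem_filter rj mem_iota szr ltn_ord.
by rewrite -val_eqE /= in jk; rewrite (negPf jk) /= => /IH ->; rewrite mulr0.
Qed.

End Elimination.

(** * Straightened forms *)

Section SignedSumPerm.
Variables (V : lmodType rat).

Definition sflip (K : Type) (e : seq (bool * K)) : seq (bool * K) :=
  [seq (~~ t.1, t.2) | t <- e].

Lemma signed_sum_flip (K : Type) (h : K -> V) e :
  signed_sum h (sflip e) = - signed_sum h e.
Proof.
rewrite /signed_sum big_map -sumrN; apply: eq_bigr => t _ /=.
by rewrite signrN scaleNr.
Qed.

Lemma signed_sum_perm (K : eqType) (h : K -> V) e e' :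
  perm_eq e e' -> signed_sum h e = signed_sum h e'.
Proof. by move=> p; apply: perm_big. Qed.

(** The key travels with its element, so sorting computes it once per term, and equality of two
    halves is equality of the elements themselves. *)
Definition sorted_half (K : Type) (key : K -> N) (b : bool) (e : seq (bool * K)) :
    seq (N * K) :=
  sort (relpre fst N.leb) [seq (key t.2, t.2) | t <- e & t.1 == b].

Lemma signed_sum_cancel (K : eqType) (key : K -> N) (h : K -> V) e :
  sorted_half key true e = sorted_half key false e -> signed_sum h e = 0.
Proof.
move=> halves.
have p : perm_eq [seq (key t.2, t.2) | t <- e & t.1 == true]
                 [seq (key t.2, t.2) | t <- e & t.1 == false].
  rewrite -(perm_sort (relpre fst N.leb)) perm_sym -(perm_sort (relpre fst N.leb)).
  by move: halves; rewrite /sorted_half => ->.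
rewrite /signed_sum (bigID (fun t => t.1 == true)) /=.
rewrite (eq_bigr (fun t => - h t.2)) => [|t /eqP->]; last by rewrite scaleN1r.
rewrite [X in _ + X](eq_big (fun t => t.1 == false) (fun t => h t.2)); last first.
- by move=> t; rewrite eqb_id => /negPf->; rewrite scale1r.
- by move=> t; case: t.1.
rewrite sumrN -[X in - X]big_filter -[X in _ + X]big_filter.
have sumE s : \sum_(t <- s) h t.2 = \sum_(t <- [seq (key t.2, t.2) | t <- s]) h t.2.
  by rewrite big_map.
by rewrite [X in - X]sumE [X in _ + X]sumE (perm_big _ p) addNr.
Qed.

End SignedSumPerm.

Section SignedMonomials.
Variable n : nat.
Implicit Types (e : seq (bool * tmon 'I_n)) (m : tmon 'I_n).

Lemma mcoeff_mon m m' : (mon m)@_m' = (m == m')%:R :> rat.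
Proof. by rewrite mon.unlock mcoeffU. Qed.

Lemma mcoeff_signed_sum e m : m \notin [seq t.2 | t <- e] -> (signed_sum (@mon _) e)@_m = 0.
Proof.
elim: e => [|t e IH] /=; first by rewrite signed_sum_nil mcoeff0.
rewrite inE negb_or => /andP[tm me].
by rewrite signed_sum_cons mcoeffD IH // addr0 mcoeffZ mcoeff_mon eq_sym (negPf tm) mulr0.
Qed.

Lemma msupp_signed_sum e : uniq [seq t.2 | t <- e] ->
  msupp (signed_sum (@mon _) e) =i [seq t.2 | t <- e].
Proof.
elim: e => [_ m|t e IH /= /andP[te ue] m]; first by rewrite signed_sum_nil msupp0 in_fset0.
rewrite -mcoeff_neq0 signed_sum_cons mcoeffD mcoeffZ mcoeff_mon inE (eq_sym t.2).
have [->|mt] := eqVneq m t.2.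
  by rewrite mcoeff_signed_sum // addr0 mulr1 signr_eq0.
by rewrite mulr0 add0r mcoeff_neq0 IH.
Qed.

Lemma pi_signed_sum e : pi_pata (signed_sum (@mon _) e) = signed_sum (@pi_mon n) e.
Proof. by rewrite (signed_sum_linear _ _ (@pi_pata_linear _)). Qed.

Lemma pi_outer_ext f : pi_pata (outer_ext f) = pi_pata f :> free_pata 'I_n.
Proof.
move: f; apply: lext_ext => [k x y|k x y|m]; rewrite ?outer_ext_linear ?pi_pata_linear //.
by rewrite /outer_ext lextU pi_signed_sum -pi_mon_outer /pi_mon mon.unlock.
Qed.

Lemma free_ternaryE (f : free_ternary 'I_n) : f = \sum_(m <- msupp f) f@_m *: mon m.
Proof.
rewrite {1}(monalgE f); apply: eq_bigr => m _; apply/malgP => m'.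
rewrite [LHS]mcoeffU [RHS]mcoeffZ mcoeff_mon mulr_natr; reflexivity.
Qed.

Lemma outer_ext_straightened (f : free_ternary 'I_n) :
  (forall m, m \in msupp f -> straightened7 m) -> outer_ext f = f.
Proof.
move=> sf; rewrite {2}(free_ternaryE f) /outer_ext lext.unlock.
apply: eq_big_seq => m /sf; rewrite straightened7E => /andP[_ om].
by rewrite (outer_id om) signed_sum1 scale1r.
Qed.

(** The difference is a consequence of the identities, so [outer_ext] sends it to 0; yet [outer_ext]
    fixes both forms. *)
Lemma straightened_form_inj (q : free_pata 'I_n) g g' :
  straightened_form q g -> straightened_form q g' -> g = g'.
Proof.
move=> [sg <-] [sg' /pi_pata_eq/outer_ext_cons[]].
rewrite (linear_funB (@outer_ext_linear n)) !outer_ext_straightened // => E _.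
by apply/eqP; rewrite eq_sym -subr_eq0 E.
Qed.

Lemma has_terms_signed_sum e :
  uniq [seq t.2 | t <- e] -> all (@straightened7 n) [seq t.2 | t <- e] ->
  has_terms (signed_sum (@pi_mon n) e) (size e).
Proof.
move=> ue /allP se; have fe := msupp_signed_sum ue.
have sf : straightened_form (signed_sum (@pi_mon n) e) (signed_sum (@mon _) e).
  by split=> [m|]; [rewrite fe; apply: se | exact: pi_signed_sum].
exists (signed_sum (@mon _) e); split=> // [g' sg'|].
  exact: straightened_form_inj sg' sf.
have -> : msupp (signed_sum (@mon _) e) = [fset m in [seq t.2 | t <- e]]%fset.
  by apply/fsetP => m; rewrite fe in_fset.
by rewrite card_fseq undup_id // size_map.
Qed.

Lemma has_terms_neq0 (q : free_pata 'I_n) k : has_terms q k -> k != 0%N -> q != 0.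
Proof.
case=> g [sg gU gk] k0; apply: contraNneq k0 => q0.
have s0 : straightened_form q 0.
  by split=> [m|]; rewrite ?msupp0 ?in_fset0 // q0 (linear_fun0 (@pi_pata_linear _)).
by rewrite -gk -(gU _ s0) msupp0 cardfs0.
Qed.

Lemma msupp_outer_ext (f : free_ternary 'I_n) m : m \in msupp (outer_ext f) ->
  exists2 m', m' \in msupp f & is_outer m && perm_eq (leaves m) (leaves m').
Proof.
rewrite -mcoeff_neq0 /outer_ext lext.unlock => fm.
have [m' m'f mm'] : exists2 m', m' \in msupp f & m \in [seq t.2 | t <- outer m'].
  apply/hasP; apply: contraNT fm => /hasPn nf; rewrite raddf_sum big1_seq //= => m' m'f.
  by rewrite mcoeffZ mcoeff_signed_sum ?mulr0 //; apply: nf.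
exists m' => //; have /allP := outer_normal m'.
by case/mapP: mm' => t tm ->; apply.
Qed.

(** The five association types, each rebuilding a monomial from its word of leaves. *)
Definition shapes (X : Type) (x0 : X) : seq (seq X -> tmon X) :=
  let f k s := k (fun i => Leaf (nth x0 s i)) in let N := @Node X in
  [:: f (fun x => N (N (N (x 0) (x 1) (x 2)) (x 3) (x 4)) (x 5) (x 6));
      f (fun x => N (N (x 0) (N (x 1) (x 2) (x 3)) (x 4)) (x 5) (x 6));
      f (fun x => N (N (x 0) (x 1) (x 2)) (N (x 3) (x 4) (x 5)) (x 6));
      f (fun x => N (x 0) (N (N (x 1) (x 2) (x 3)) (x 4) (x 5)) (x 6));
      f (fun x => N (x 0) (N (x 1) (x 2) (x 3)) (N (x 4) (x 5) (x 6)))]%N.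

Lemma straightened7_shape x0 m : straightened7 m ->
  m \in [seq f (leaves m) | f <- shapes x0].
Proof.
rewrite /straightened7; repeat (match goal with
  |- context [match ?t with Leaf _ => _ | Node _ _ _ => _ end] =>
    is_var t; destruct t end; try done).
all: by rewrite !inE eqxx ?orbT.
Qed.

Definition straightened_basis x0 (s : seq 'I_n) : seq (tmon 'I_n) :=
  [seq m <- flatten [seq [seq f w | f <- shapes x0] | w <- permutations s]
     | straightened7 m].

Lemma mem_straightened_basis x0 s m :
  straightened7 m -> perm_eq (leaves m) s -> m \in straightened_basis x0 s.
Proof.
move=> sm ps; rewrite mem_filter sm; apply/flatten_mapP.
by exists (leaves m); [rewrite mem_permutations | apply: straightened7_shape].
Qed.

End SignedMonomials.

(** * The partition 31111 *)

Definition leaves31111 : seq 'I_5 := [:: ga; ga; ga; gb; gc; gd; ge].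
Definition basis31111 : seq (tmon 'I_5) := straightened_basis ga leaves31111.

Definition letter (j : nat) : 'I_5 := nth ga [:: ga; gb; gc; gd; ge] j.

Lemma letterK (i : 'I_5) : letter i = i.
Proof. by apply: val_inj; case: i => [[|[|[|[|[|i]]]]]]. Qed.

(* The brackets under the four sums of I31111; s lists the images of a, ..., e. *)
Definition summand (k : nat) (s : seq nat) : tmon 'I_5 :=
  let x := Leaf ga in let y i := Leaf (letter (nth 0%N s i)) in
  let N := @Node 'I_5 in
  match k with
  | 0 => N (N (N x (y 0) (y 1)) x (y 2)) (y 3) (y 4)
  | 1 => N (N x (N (y 0) (y 1) (y 2)) x) (y 3) (y 4)
  | 2 => N (N x (y 0) (y 1)) (N (y 2) (y 3) (y 4)) x
  | _ => N x (N (N (y 1) (y 2) (y 3)) x (y 4)) (y 0)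
  end%N.

Definition alternating_sum (k : nat) : seq (bool * tmon 'I_5) :=
  sbind (sperms 5) (fun s => outer (summand k s)).

(** Multiplying the coefficients 1/4, -1/12, -1/12, -1/6 by 12 gives the integers 3, -1, -1, -2,
    realized as repetitions. *)
Definition twelvefold (K : Type) (e0 e1 e2 e3 : seq (bool * K)) :=
  e0 ++ e0 ++ e0 ++ sflip (e1 ++ e2 ++ e3 ++ e3).

Definition twelve_I31111 : seq (bool * tmon 'I_5) :=
  twelvefold (alternating_sum 0) (alternating_sum 1)
    (alternating_sum 2) (alternating_sum 3).

(** Prefix notation with digit 0 for a node, to be read as a decimal number. *)
Fixpoint tree_code (m : tmon 'I_5) : seq nat :=
  if m is Node l c r then 0%N :: tree_code l ++ tree_code c ++ tree_code r
  else if m is Leaf i then [:: i.+1] else [::].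

(* Only sorts and selects words and trees: its injectivity is never needed. *)
Definition digits_code (s : seq nat) : N :=
  foldl (fun a i => (10 * a + N.of_nat i)%num) 0%num s.

(* Every term occurs twelve times in twelve_I31111. *)
Definition terms31111 : seq (bool * tmon 'I_5) :=
  let e := sort (relpre (fun t => digits_code (tree_code t.2)) N.leb) twelve_I31111 in
  [seq nth (false, Leaf ga) e (12 * i) | i <- iota 0 60].

(** The symmetries of the brackets repeat each nonzero term of the four sums 4, 12, 12 and 6 times,
    and the multiplicities 3, 1, 1, 2 turn each of these into 12. Sorting puts equal terms side by
    side. *)
Lemma twelve_I31111_perm : perm_eq twelve_I31111 (flatten [seq nseq 12 t | t <- terms31111]).
Proof.
rewrite -(perm_sort (relpre (fun t => digits_code (tree_code t.2)) N.leb) twelve_I31111).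
set s := sort _ _; suff -> : s = flatten [seq nseq 12 t | t <- terms31111] by [].
by vm_compute.
Qed.

Definition summand_value (k : nat) (y : 'I_5 -> free_pata 'I_5) : free_pata 'I_5 :=
  let x := gen ga in
  match k with
  | 0 => br (br (br x (y ga) (y gb)) x (y gc)) (y gd) (y ge)
  | 1 => br (br x (br (y ga) (y gb) (y gc)) x) (y gd) (y ge)
  | 2 => br (br x (y ga) (y gb)) (br (y gc) (y gd) (y ge)) x
  | _ => br x (br (br (y gb) (y gc) (y gd)) x (y ge)) (y ga)
  end%N.

Lemma pi_mon_summand k (s : 'S_5) :
  pi_mon (summand k [seq val (s i) | i <- enum 'I_5]) =
  summand_value k (fun i => gen (s i)).
Proof.
have -> : [seq val (s i) | i <- enum 'I_5] =
    [:: val (s ga); val (s gb); val (s gc); val (s gd); val (s ge)].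
  rewrite (_ : enum 'I_5 = [:: ga; gb; gc; gd; ge]) //.
  by apply: (inj_map val_inj); rewrite val_enum_ord.
by case: k => [|[|[|k]]]; rewrite /summand /= !letterK !pi_mon_node !pi_mon_leaf.
Qed.

Lemma alternating_sumE k : signed_sum (@pi_mon 5) (alternating_sum k) =
  \sum_(s : 'S_5) (-1) ^+ s *: summand_value k (fun i => gen (s i)).
Proof.
transitivity (signed_sum (fun s => pi_mon (summand k s)) (sperms 5)).
  by rewrite signed_sum_bind; apply: signed_sum_eq => s; rewrite -pi_mon_outer.
rewrite -(@sum_perms 5 _ (fun s => pi_mon (summand k s))).
by apply: eq_bigr => s _; rewrite pi_mon_summand.
Qed.

Lemma signed_sum_twelvefold (K : Type) (V : lmodType rat) (h : K -> V) e0 e1 e2 e3 :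
  signed_sum h (twelvefold e0 e1 e2 e3) =
  12%:R *: (4%:R^-1 *: signed_sum h e0 - 12%:R^-1 *: signed_sum h e1
    - 12%:R^-1 *: signed_sum h e2 - 6%:R^-1 *: signed_sum h e3).
Proof.
rewrite !signed_sum_cat signed_sum_flip !signed_sum_cat !scalerBr !scalerA.
rewrite (_ : 12%:R * 4%:R^-1 = 3%:R :> rat) // (_ : 12%:R * 12%:R^-1 = 1 :> rat) //.
rewrite (_ : 12%:R * 6%:R^-1 = 2%:R :> rat) // !scaler_nat !scale1r.
by rewrite mulr2n !mulrS mulr0n addr0 !opprD !addrA.
Qed.

Lemma I31111E : I31111 = signed_sum (@pi_mon 5) terms31111.
Proof.
have h12 : (12%:R : rat) != 0 by [].
apply: (scalerI h12).
transitivity (signed_sum (@pi_mon 5) twelve_I31111); last first.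
  rewrite (signed_sum_perm _ twelve_I31111_perm).
  rewrite /signed_sum big_flatten big_map scaler_sumr; apply: eq_bigr => t _.
  by rewrite big_nseq iter_addr_0 scaler_nat.
by rewrite signed_sum_twelvefold !alternating_sumE.
Qed.

Lemma terms31111_uniq : uniq [seq t.2 | t <- terms31111].
Proof. by vm_compute. Qed.

Lemma terms31111_straightened :
  all (fun m => straightened7 m && perm_eq (leaves m) leaves31111)
    [seq t.2 | t <- terms31111].
Proof. by vm_compute. Qed.

Lemma has_terms31111 : has_terms I31111 60.
Proof.
rewrite I31111E -[60%N](_ : size terms31111 = 60%N); last by rewrite size_map size_iota.
apply: has_terms_signed_sum terms31111_uniq _.
by apply: sub_all terms31111_straightened => m /andP[].
Qed.

Lemma V31111_I31111 : V31111 I31111.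
Proof.
exists (signed_sum (@mon _) terms31111); split=> [m|]; last first.
  by rewrite I31111E pi_signed_sum.
rewrite (msupp_signed_sum terms31111_uniq).
by move/(allP terms31111_straightened)/andP=> [].
Qed.

Definition word_key (w : word 'I_5) : N :=
  digits_code ((size w.1.1).+1 :: [seq val i | i <- w.1.1 ++ w.1.2 :: w.2]).

(** Each monomial expands into 216 signed words; over the 60 terms, the positive and the negative
    words form the same multiset. *)
Lemma expansion31111 : let e := sbind terms31111 (@expand 'I_5) in
  sorted_half word_key true e = sorted_half word_key false e.
Proof. by vm_compute. Qed.

Lemma identity31111 : pats_identity I31111.
Proof.
move=> D v; rewrite I31111E -pi_signed_sum pata_eval_pi.
rewrite /free_eval (signed_sum_linear _ _ (lext_linear _)).
transitivity (signed_sum (fun m => signed_sum (wval v) (expand m)) terms31111).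
  by apply: signed_sum_eq => m /=; rewrite lext_mon mon_eval_expand.
by rewrite -signed_sum_bind; apply/signed_sum_cancel/expansion31111.
Qed.

(** * The linear system for the coefficients and its elimination *)

Definition signed_count (K : Type) (P : pred K) (e : seq (bool * K)) : int :=
  (count (fun t => ~~ t.1 && P t.2) e)%:Z - (count (fun t => t.1 && P t.2) e)%:Z.

Lemma signed_countE (K : Type) (P : pred K) e :
  (signed_count P e)%:~R = signed_sum (fun k => (P k)%:R : rat^o) e :> rat.
Proof.
elim: e => [|t e IH]; first by rewrite signed_sum_nil.
rewrite signed_sum_cons -IH /signed_count /= !PoszD opprD addrACA rmorphD /=; congr (_ + _).
by case: t.1; case: (P t.2).
Qed.

Lemma signed_count_filter_map (K L : Type) (f : K -> L) (Q : pred K) (P : pred L) e :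
  signed_count P [seq (t.1, f t.2) | t <- e & Q t.2] =
  signed_count (fun k => Q k && P (f k)) e.
Proof.
by rewrite /signed_count !count_map !count_filter; congr (Posz _ - Posz _);
  apply: eq_count => t /=; rewrite -andbA (andbC (P _)).
Qed.

Lemma lext_seq (K : choiceType) (V : lmodType rat) (h : K -> V) (s : seq K) f :
  uniq s -> {subset msupp f <= s} -> lext h f = \sum_(k <- s) f@_k *: h k.
Proof.
move=> us fs; rewrite (@lextEw _ _ h [fset k in s]%fset); last first.
  by apply/fsubsetP => k kf; rewrite in_fset; apply: fs.
apply: perm_big; apply: uniq_perm => // k; by rewrite in_fset.
Qed.

(** One equation of the system: the linear functional sending a word to 1 or 0 according to [P] is
    applied to the vanishing evaluation. Allowing any predicate lets a key select the words. *)
Lemma free_eval_count (X : choiceType) (P : pred (word X)) (s : seq (tmon X)) f :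
  uniq s -> {subset msupp f <= s} -> free_eval (@free_dialg_gen X) f = 0 ->
  \sum_(m <- s) (signed_count P (expand m))%:~R * f@_m = 0.
Proof.
move=> us fs f0.
pose l : {malg rat[word X]} -> rat^o := lext (fun w => (P w)%:R : rat^o).
have ll : linear l by apply: lext_linear.
rewrite -[RHS](linear_fun0 ll) -[in RHS]f0 /free_eval (lext_seq _ us fs) linear_fun_sum //.
apply: eq_bigr => m _; rewrite linear_funZ // mon_eval_expand signed_sum_linear //.
rewrite (@signed_sum_eq rat^o _ _ (fun w => (P w)%:R)) => [|w]; last first.
  by rewrite /= wval_free /l lext_mon.
by rewrite -signed_countE mulrC.
Qed.

(* Found by a greedy elimination that keeps the rows sparse. The first digit of a
   key is one more than the position of the central letter, which is at most 1. *)
Definition keys31111 : seq N :=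
  [:: 11000234; 11000243; 11000342; 11200034; 11230004; 11240003; 11300024;
      11340002; 11400023; 12000134; 12000143; 12000341; 12100034; 12130004;
      12140003; 12300014; 12340001; 12400013; 13000124; 13000142; 13000241;
      13100024; 13120004; 13140002; 13200014; 13240001; 13400012; 14000123;
      14000132; 14000231; 14100023; 14120003; 14130002; 14200013; 14230001;
      14300012; 21230004; 21240003; 21320004; 21340002; 21420003; 21430002;
      22130004; 22140003; 22310004; 22340001; 22410003; 22430001; 23120004;
      23140002; 23210004; 23240001; 23410002; 23420001; 24120003; 24130002;
      24210003; 24230001; 24310002; 24320001; 10001234; 10002134; 10001243;
      10001342; 10003142; 10001432; 10001423; 10004132; 10001324; 10002341;
      10002314; 10002431; 10002413; 10134200; 10130042; 10143200; 10140032;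
      10234100; 10243100; 10003412; 10003421; 10124300; 10120043; 10200143;
      22000143; 10020143; 23020014; 22000134; 24020013; 10200341; 10200134;
      10020134; 22000314; 10203041; 20023104; 20024103; 20021304; 22000341;
      20023401; 10203140; 10204130; 10201340; 10201430; 10203410; 10204310;
      20020314; 10203104; 10230140; 23020104; 20020134; 10320140; 10341200;
      10023140; 10210340; 10130240; 20010324; 20030124; 20012304; 20032104;
      20020413; 10204103; 10013204; 10031204; 10240130; 10420130; 10024130;
      10210430; 10410230; 20040123; 20010423; 20012403; 20042103; 20041203;
      21002034; 10104032; 20014302; 22001304; 10012340; 20010432; 20010342;
      10023410; 10230410; 10320410; 10240310; 20040321; 20042301; 10430210;
      20030421; 20032401; 10043012; 24002013; 20043102; 20040132; 20034102;
      22040103; 10042130; 10034012; 10032014; 22030104; 10032140; 10140302;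
      10340120; 10014320; 23010402]%num.

(** Words whose centre lies further right are dropped early, since the chosen keys never match
    them. *)
Definition keyed_expansion (m : tmon 'I_5) : seq (bool * N) :=
  [seq (t.1, word_key t.2) | t <- expand m & (size t.2.1.1 <= 1)%N].

Definition rows31111 : seq (seq int) :=
  let expansions := map keyed_expansion basis31111 in
  [seq [seq signed_count (N.eqb k) e | e <- expansions] | k <- keys31111].

Lemma basis31111_uniq : uniq basis31111.
Proof. by vm_compute. Qed.

Lemma size_basis31111 : size basis31111 = 165%N.
Proof. by vm_compute. Qed.

(** Index 164 is the last basis monomial, assumed to have coefficient 0; the equations then force
    all 165 coefficients to vanish. *)
Lemma zeros31111 :
  let zeros := propagate [:: 164%N] (echelon [::] rows31111) in
  all (fun i => i \in zeros) (iota 0 165).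
Proof. by vm_compute. Qed.

Definition last31111 : tmon 'I_5 := nth (Leaf ga) basis31111 164.

Lemma last31111_term : last31111 \in [seq t.2 | t <- terms31111].
Proof. by vm_compute. Qed.

Lemma annihilates_rows31111 (f : free_ternary 'I_5) :
  {subset msupp f <= basis31111} -> free_eval (@free_dialg_gen 'I_5) f = 0 ->
  forall r, r \in rows31111 ->
  annihilates 165 (fun i => f@_(nth (Leaf ga) basis31111 i)) r.
Proof.
move=> fs f0 r /mapP[k _ ->]; split; first by rewrite !size_map size_basis31111.
rewrite -[RHS](free_eval_count (fun w => (size w.1.1 <= 1)%N && N.eqb k (word_key w))
  basis31111_uniq fs f0).
rewrite (big_nth (Leaf ga)) size_basis31111 big_mkord; apply: eq_bigr => i _.
have i165 : (i < size basis31111)%N by rewrite size_basis31111.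
rewrite -map_comp (nth_map (Leaf ga)) //; congr (_%:~R * _).
exact: (signed_count_filter_map word_key (fun w => (size w.1.1 <= 1)%N) (N.eqb k)).
Qed.

(** A solution is determined by its coefficient at the last monomial, so the solution space has
    dimension at most one. *)
Lemma free_eval_last_eq0 (f : free_ternary 'I_5) :
  {subset msupp f <= basis31111} -> free_eval (@free_dialg_gen 'I_5) f = 0 ->
  f@_last31111 = 0 -> f = 0.
Proof.
move=> fs f0 fl; apply/malgP => m; rewrite mcoeff0.
have [mf|/mcoeff_outdom //] := boolP (m \in msupp f).
have mb := fs _ mf.
have ib : index m basis31111 \in iota 0 165.
  by rewrite mem_iota -[165%N]size_basis31111 index_mem.
have := propagate_zeros (c := fun i => f@_(nth (Leaf ga) basis31111 i)) (n := 165)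
  (zeros := [:: 164%N]) (pivots := echelon [::] rows31111).
move/(_ _ _ _ (allP zeros31111 _ ib)); rewrite nth_index //; apply.
  by apply: annihilates_echelon => //; apply: annihilates_rows31111.
by move=> i; rewrite inE => /eqP->.
Qed.

Lemma N31111_multiple f : N31111 f -> exists k : rat, f = k *: I31111.
Proof.
case=> -[g [gs gf]] idf.
pose I := signed_sum (@mon _) terms31111.
have piI : pi_pata I = I31111 by rewrite I31111E pi_signed_sum.
have basisP m : straightened7 m -> perm_eq (leaves m) leaves31111 -> m \in basis31111.
  exact: mem_straightened_basis.
have Is : {subset msupp I <= basis31111}.
  move=> m; rewrite (msupp_signed_sum terms31111_uniq).
  by move/(allP terms31111_straightened)/andP=> [? ?]; apply: basisP.
have Os : {subset msupp (outer_ext g) <= basis31111}.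
  move=> m /msupp_outer_ext[m' /gs p' /andP[om pm]].
  have p : perm_eq (leaves m) leaves31111 by apply: perm_trans pm p'.
  by apply: basisP => //; rewrite straightened7E om (perm_size p).
have Il : I@_last31111 != 0.
  by rewrite mcoeff_neq0 (msupp_signed_sum terms31111_uniq) last31111_term.
(* With this [k], the normalized representative minus [k] times that of [I31111] has coefficient 0
   at the last monomial. *)
pose k := (outer_ext g)@_last31111 / I@_last31111; exists k.
suff E : outer_ext g - k *: I = 0.
  rewrite -gf -(pi_outer_ext g) -piI -(linear_funZ (@pi_pata_linear _)).
  by congr pi_pata; apply/eqP; rewrite -subr_eq0 E.
apply: free_eval_last_eq0.
- move=> m; rewrite -mcoeff_neq0 mcoeffB mcoeffZ; apply: contraR => mb.
  by rewrite !mcoeff_outdom ?mulr0 ?subrr // (contra (@Is _), contra (@Os _)).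
(* Both elements are identities, so in particular their difference vanishes in the free
   dialgebra. *)
- have lE : linear (free_eval (@free_dialg_gen 'I_5)) by apply: lext_linear.
  rewrite (linear_funB lE) (linear_funZ lE) -!pata_eval_pi piI pi_outer_ext gf.
  by rewrite idf identity31111 scaler0 subrr.
- by rewrite mcoeffB mcoeffZ /k divfK // subrr.
Qed.

Theorem theorem8p3 :
  [/\ one_dimensional N31111,
      N31111 I31111,
      I31111 != 0,
      forall f, N31111 f -> exists k : rat, f = k *: I31111
    & has_terms I31111 60].
Proof.
have NI : N31111 I31111 by split; [exact: V31111_I31111 | exact: identity31111].
have I0 : I31111 != 0 by apply: has_terms_neq0 has_terms31111 _.
split=> //; [|exact: N31111_multiple|exact: has_terms31111].
exists I31111 => // f; split=> [|[k ->]]; first exact: N31111_multiple.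
have [[g [gs gI]] idI] := NI; split.
  (* Scaling a representative does not enlarge its support, so multiples stay in the component. *)
  exists (k *: g); split=> [m /(fsubsetP (msuppZ_le _ _))/gs //|].
  by rewrite (linear_funZ (@pi_pata_linear _)) gI.
move=> D v; rewrite -gI -(linear_funZ (@pi_pata_linear _)) pata_eval_pi.
rewrite (linear_funZ (lext_linear _ : linear (free_eval v))) -pata_eval_pi gI.
by rewrite idI scaler0.
Qed.
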